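(* Let $H$ and $K$ be nontrivial finitely generated subgroups of a free group, of ranks $h$ and $k$ respectively. If $$\operatorname{rank}(H\vee K) - 1 \;\geq\; \frac{h+k-1}{2},$$ then $$\operatorname{rank}(H\cap K) - 1 \;\leq\; (h-1)(k-1).$$
   Context: For subgroups $H$ and $K$ of a free group, $H\vee K=\langle H,K\rangle$ denotes their join, i.e. the subgroup generated by $H\cup K$. The rank of a free group is the cardinality of a free basis; the trivial group has rank $0$. *)

(* Defs.v *)
From mathcomp Require Import all_boot all_order all_algebra.
From mathcomp Require Import boolp classical_sets functions cardinality.

Set Implicit Arguments.
Unset Strict Implicit.
Unset Printing Implicit Defensive.

Local Open Scope classical_set_scope.
Local Open Scope group_scope.

Section FreeGroups.
Variable G : groupType.
Implicit Types (S H K : set G) (w : seq (G * bool)) (n : nat).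

Definition is_subgroup H : Prop := group_closed [in H].

Definition generated S : set G := smallest is_subgroup S.

Definition subgroup_join H K : set G := generated (H `|` K).

Definition finitely_generated H : Prop :=
  exists2 S, finite_set S & generated S = H.

(* The pair (x, false) stands for the letter x, and (x, true) for the formal
   inverse of x, so that a word over S is a sequence of pairs whose first
   components lie in S. *)
Definition word_over S w : Prop := forall l, l \in w -> S l.1.

Definition inverse_letters (l m : G * bool) : bool :=
  (l.1 == m.1) && (l.2 != m.2).

Definition reduced w : bool := sorted (fun l m => ~~ inverse_letters l m) w.

Definition word_val w : G := \prod_(l <- w) (if l.2 then l.1^-1 else l.1).

(* S freely generates H: S generates H, and no nonempty reduced word over S
   represents the identity.  Neither S nor its cardinality is restricted. *)
Definition free_basis S H : Prop :=
  generated S = H /\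
  forall w, word_over S w -> reduced w -> w <> [::] -> word_val w <> 1.

(* Rank is a relation rather than a function, so that no junk value is assigned
   to a subgroup that has no finite free basis. *)
Definition has_rank H n : Prop := exists2 S, free_basis S H & (S #= `I_n)%card.

End FreeGroups.

Definition is_free_group (G : groupType) : Prop :=
  exists S : set G, free_basis S [set: G].

(* Main.v *)
Require Import Defs.
From mathcomp Require Import all_boot all_order all_algebra.
From mathcomp Require Import boolp classical_sets functions cardinality.
From mathcomp Require Import wochoice zify.

(* Mineyev's proof of the Hanna Neumann conjecture, as simplified by Dicks.

   Let S be a free basis of the ambient group G and T the Cayley tree.  Some
   total order on the vertices of T, that is, on G, is invariant under left
   translation, and it induces an invariant total order on the edges.  Let V be
   a subtree of T on which H acts with finitely many orbits.  Call an edge of V a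
   bridge if both balls obtained at its ends, by keeping only the smaller edges,
   are infinite.  A ball is finite exactly when it meets each H-orbit at most
   once, because an element of H moving a vertex within a ball can be iterated,
   in one of its two directions, along smaller and smaller edges.  Hence each
   vertex of V can be matched equivariantly with exactly one edge that is not a
   bridge (if V is infinite), so that the number of orbits of bridges is
   |X/H| - |V/H|, where X is the set of edges of V, that is, rank H - 1.  As a
   bridge of a subtree is a bridge of the larger tree, and as G acts freely on
   edges, the orbits of bridges of V_H :&: V_K under the intersection of H and K
   inject into the pairs formed by an orbit of bridges for H and one for K. *)

Set Implicit Arguments.
Unset Strict Implicit.
Unset Printing Implicit Defensive.

Local Open Scope classical_set_scope.
Local Open Scope group_scope.

(** * Subgroups, words and walks in the Cayley graph *)

Section Subgroups.
Variable G : groupType.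
Implicit Types (H S : set G) (x y : G).

Lemma subgroupP H :
  is_subgroup H <-> [/\ H 1, forall x y, H x -> H y -> H (x * y)
                           & forall x, H x -> H x^-1].
Proof.
split=> [gH | [H1 HM HV]].
  have /= HV := group_closedV gH; have /= HM := group_closedM gH.
  split; first by have [] := gH; rewrite inE.
    by move=> x y Hx Hy; apply/set_mem/HM; apply/mem_set.
  by move=> x Hx; apply/set_mem/HV/mem_set.
split=> [|x y]; first by rewrite inE.
by rewrite !inE => Hx Hy; apply: HM => //; apply: HV.
Qed.

Lemma subgroup1 H : is_subgroup H -> H 1.
Proof. by case/subgroupP. Qed.

Lemma subgroupM H x y : is_subgroup H -> H x -> H y -> H (x * y).
Proof. by case/subgroupP => _ HM _; apply: HM. Qed.

Lemma subgroupV H x : is_subgroup H -> H x -> H x^-1.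
Proof. by case/subgroupP => _ _; apply. Qed.

Lemma generated_sub S : S `<=` generated S.
Proof. exact: sub_gen_smallest. Qed.

Lemma generated_min S H : is_subgroup H -> S `<=` H -> generated S `<=` H.
Proof. exact: smallest_sub. Qed.

Lemma is_subgroup_generated S : is_subgroup (generated S).
Proof.
apply/subgroupP; split=> [A [/subgroup1 //]|x y Sx Sy A AP|x Sx A AP].
- by apply: subgroupM; [case: AP|apply: Sx|apply: Sy].
- by apply: subgroupV; [case: AP|apply: Sx].
Qed.

Lemma is_subgroupI H K : is_subgroup H -> is_subgroup K -> is_subgroup (H `&` K).
Proof.
move=> gH gK; apply/subgroupP; split=> [|x y [? ?] [? ?]|x [? ?]].
- by split; apply: subgroup1.
- by split; apply: subgroupM.
- by split; apply: subgroupV.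
Qed.

End Subgroups.

Section Words.
Variable G : groupType.
Implicit Types (S : set G) (x y g : G) (l m : G * bool) (u v w : seq (G * bool)).

Definition letter_val l : G := if l.2 then l.1^-1 else l.1.

Definition letter_inv l : G * bool := (l.1, ~~ l.2).

Definition word_inv w := rev (map letter_inv w).

Lemma letter_invK : involutive letter_inv.
Proof. by case=> s b; rewrite /letter_inv /= negbK. Qed.

Lemma inverse_lettersE l m : inverse_letters l m = (m == letter_inv l).
Proof.
case: l m => [s b] [t c]; rewrite /inverse_letters /letter_inv /= xpair_eqE.
by rewrite eq_sym; congr (_ && _); case: b c => [] [].
Qed.

Lemma letter_val_inv l : letter_val (letter_inv l) = (letter_val l)^-1.
Proof. by case: l => s []; rewrite /letter_val /= ?invgK. Qed.

Lemma word_val_nil : word_val [::] = 1 :> G.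
Proof. by rewrite /word_val big_nil. Qed.

Lemma word_val_cons l w : word_val (l :: w) = letter_val l * word_val w.
Proof. by rewrite /word_val big_cons. Qed.

Lemma word_val_cat u v : word_val (u ++ v) = word_val u * word_val v.
Proof. by rewrite /word_val big_cat. Qed.

Lemma word_val_inv w : word_val (word_inv w) = (word_val w)^-1.
Proof.
elim: w => [|l w IH]; first by rewrite word_val_nil invg1.
rewrite /word_inv /= rev_cons -cats1 word_val_cat -/(word_inv w) IH.
by rewrite !word_val_cons word_val_nil mulg1 letter_val_inv invgM.
Qed.

Lemma word_over_cons S l w : word_over S (l :: w) <-> S l.1 /\ word_over S w.
Proof.
split=> [Sw | [Sl Sw] m]; last by rewrite inE => /orP[/eqP -> //|/Sw].
by split=> [|m mw]; apply: Sw; rewrite inE ?eqxx ?mw ?orbT.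
Qed.

Lemma word_over_cat S u v :
  word_over S (u ++ v) <-> word_over S u /\ word_over S v.
Proof.
split=> [Sw | [Su Sv] l]; last by rewrite mem_cat => /orP[/Su|/Sv].
by split=> l lw; apply: Sw; rewrite mem_cat lw ?orbT.
Qed.

Lemma word_over_inv S w : word_over S w -> word_over S (word_inv w).
Proof. by move=> Sw l; rewrite mem_rev => /mapP[m /Sw Sm ->]. Qed.

Lemma generated_word S g :
  generated S g -> exists2 w, word_over S w & word_val w = g.
Proof.
apply: (@generated_min G S [set g | exists2 w, word_over S w & word_val w = g]).
  apply/subgroupP; split=> [|_ _ [u Su <-] [v Sv <-]|_ [u Su <-]].
  - by exists [::]; rewrite ?word_val_nil.
  - by exists (u ++ v); rewrite ?word_val_cat //; apply/word_over_cat.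
  - by exists (word_inv u); [apply: word_over_inv|rewrite word_val_inv].
move=> s Ss; exists [:: (s, false)]; last by rewrite word_val_cons word_val_nil mulg1.
by apply/word_over_cons.
Qed.

Lemma unreducedP w : ~~ reduced w ->
  exists u l v, w = u ++ l :: letter_inv l :: v.
Proof.
elim: w => [//|l [//|m w] IH]; rewrite /reduced /= negb_and negbK.
case/orP=> [|/IH[u [k [v ->]]]]; last by exists (l :: u), k, v.
by rewrite inverse_lettersE => /eqP->; exists [::], l, w.
Qed.

End Words.

Section Walks.
Variable G : groupType.
Implicit Types (S : set G) (x y g : G) (e : G * G) (l m : G * bool)
  (u v w : seq (G * bool)).

(* The edge (x, s) of the Cayley graph joins x to x * s. *)
Definition edge_at x l : G * G := if l.2 then (x * l.1^-1, l.1) else (x, l.1).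

Fixpoint walk x w : seq (G * G) :=
  if w is l :: w' then edge_at x l :: walk (x * letter_val l) w' else [::].

Definition edge_act g e : G * G := (g * e.1, e.2).

Lemma edge_act1 e : edge_act 1 e = e.
Proof. by case: e => x s; rewrite /edge_act mul1g. Qed.

Lemma edge_actM g g' e : edge_act (g * g') e = edge_act g (edge_act g' e).
Proof. by rewrite /edge_act /= mulgA. Qed.

Lemma edge_actK g : cancel (edge_act g) (edge_act g^-1).
Proof. by move=> e; rewrite -edge_actM mulVg edge_act1. Qed.

Lemma edge_act_inj g : injective (edge_act g).
Proof. exact: can_inj (edge_actK g). Qed.

Lemma edge_act_free g e : edge_act g e = e -> g = 1.
Proof. by case: e => x s [gx]; apply: (@mulIg _ x); rewrite gx mul1g. Qed.

Lemma walk_cat x u v : walk x (u ++ v) = walk x u ++ walk (x * word_val u) v.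
Proof.
elim: u x => [|l u IH] x /=; first by rewrite word_val_nil mulg1.
by rewrite IH word_val_cons mulgA.
Qed.

Lemma edge_at_inv x l : edge_at (x * letter_val l) (letter_inv l) = edge_at x l.
Proof. by case: l => s []; rewrite /edge_at /letter_val /= ?mulgK. Qed.

Lemma walk_inv x w : walk (x * word_val w) (word_inv w) = rev (walk x w).
Proof.
elim: w x => [//|l w IH] x /=; rewrite /word_inv /= !rev_cons -!cats1 walk_cat.
rewrite -/(word_inv w) word_val_cons mulgA IH word_val_inv mulgK /=.
by rewrite edge_at_inv.
Qed.

Lemma walk_act g x w : walk (g * x) w = map (edge_act g) (walk x w).
Proof.
elim: w x => [//|l w IH] x /=; rewrite -mulgA IH; congr (_ :: _).
by rewrite /edge_at /edge_act; case: l.2; rewrite /= ?mulgA.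
Qed.

Lemma walk_sum (c : G -> bool) x w :
  c x (+) c (x * word_val w) =
  \big[addb/false]_(e <- walk x w) (c e.1 (+) c (e.1 * e.2)).
Proof.
elim: w x => [|l w IH] x; first by rewrite big_nil word_val_nil mulg1 addbb.
rewrite big_cons -IH word_val_cons mulgA addbA; congr (_ (+) _).
rewrite /edge_at /letter_val; case: l.2 => /=; last by rewrite -addbA addbb addbF.
by rewrite mulgVK [X in X (+) _]addbC -addbA addbb addbF.
Qed.

(** Only the parity is kept: it does not change when a backtracking pair of letters is deleted, so
    walks can be concatenated without being reduced. *)
Definition crossings e x w : bool := odd (count_mem e (walk x w)).

Lemma crossings_cat e x u v :
  crossings e x (u ++ v) = crossings e x u (+) crossings e (x * word_val u) v.
Proof. by rewrite /crossings walk_cat count_cat oddD. Qed.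

Lemma crossings_inv e x w :
  crossings e (x * word_val w) (word_inv w) = crossings e x w.
Proof. by rewrite /crossings walk_inv count_rev. Qed.

Lemma crossings_act g e x w :
  crossings (edge_act g e) (g * x) w = crossings e x w.
Proof.
rewrite /crossings walk_act count_map; congr odd; apply: eq_count => f /=.
exact: inj_eq (@edge_act_inj g) f e.
Qed.

Lemma sum_addb_parity (T : eqType) (r : seq T) (f : T -> bool) :
  \big[addb/false]_(e <- r) f e =
  \big[addb/false]_(e <- undup r) (odd (count_mem e r) && f e).
Proof.
rewrite -big_undup_iterop_count; apply: eq_bigr => e _; move: (f e) => b.
elim: (count_mem e r) => [|[|n] IH] //.
rewrite -[LHS]/(b (+) iterop n.+1 addb b false) IH /=.
by case: (odd n) => /=; rewrite ?addbb ?addbF.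
Qed.

(* Each edge that is crossed an odd number of times contributes once. *)
Lemma walk_constant (c : G -> bool) x w :
  (forall e, crossings e x w -> c e.1 = c (e.1 * e.2)) ->
  c x = c (x * word_val w).
Proof.
move=> ce; suff: c x (+) c (x * word_val w) = false.
  by case: (c x); case: (c (x * _)).
rewrite walk_sum sum_addb_parity big1_seq // => e _.
by case E: (odd _) => //=; rewrite ce ?addbb.
Qed.

End Walks.

(** * Separation by edges of the Cayley tree *)

Section Separation.
Variables (G : groupType) (S : set G).
Implicit Types (x y z g : G) (e : G * G) (w : seq (G * bool)).

(** The chosen word need not be reduced: in a free group the parity of crossings depends only on the
    ends of a walk over [S]. The default [[::]] is not reached when [S] generates. *)
Definition word_of x : seq (G * bool) :=
  xget [::] [set w | word_over S w /\ word_val w = x].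

(* Removing the edge e cuts the Cayley tree in two halves; side e tells in
   which half a vertex lies, and sep e x y says that e lies on the geodesic
   from x to y. *)
Definition side e x := crossings e 1 (word_of x).

Definition sep e x y := side e x (+) side e y.

(** A primitive of [f] modulo 2, normalized to vanish at 1: see [potential1] and
    [potential_edge]. *)
Definition potential (f : G * G -> bool) x : bool :=
  \big[addb/false]_(e <- walk 1 (word_of x)) f e.

Lemma sepxx e x : sep e x x = false.
Proof. exact: addbb. Qed.

Lemma sepC e x y : sep e x y = sep e y x.
Proof. exact: addbC. Qed.

Lemma sepD e y x z : sep e x z = sep e x y (+) sep e y z.
Proof. by rewrite /sep; case: (side e x); case: (side e y); case: (side e z). Qed.

Lemma sep_split e y x z : sep e x z -> sep e x y \/ sep e y z.
Proof. by rewrite (sepD e y); case: (sep e x y); [left|right]. Qed.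

Hypothesis freeS : free_basis S [set: G].

Lemma word_of_over x : word_over S (word_of x).
Proof.
have [w Sw wx] : exists2 w, word_over S w & word_val w = x.
  by apply: generated_word; rewrite (proj1 freeS).
by case: (@xgetPex _ [::] [set w | word_over S w /\ word_val w = x]); first by exists w.
Qed.

Lemma word_ofK x : word_val (word_of x) = x.
Proof.
have [w Sw wx] : exists2 w, word_over S w & word_val w = x.
  by apply: generated_word; rewrite (proj1 freeS).
by case: (@xgetPex _ [::] [set w | word_over S w /\ word_val w = x]); first by exists w.
Qed.

(** The Cayley graph has no cycles: by freeness a nonempty word of value 1 contains a cancelling
    pair, which crosses one edge twice. Deleting the pair keeps all parities and shortens the
    word. *)
Lemma crossings_loop e x w :
  word_over S w -> word_val w = 1 -> crossings e x w = false.
Proof.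
elim/ltn_ind: (size w) {-2}w (erefl (size w)) => n IH {}w szw Sw w1.
have [/eqP w0 | w0] := eqVneq w [::]; first by rewrite (eqP w0).
have : ~~ reduced w.
  by apply/negP => rw; case: freeS => _ /(_ w Sw rw); apply; first exact/eqP.
case/unreducedP => u [l [v def_w]]; move: szw Sw w1; rewrite {}def_w.
have llv : forall w', word_val (l :: letter_inv l :: w') = word_val w'.
  by move=> w'; rewrite !word_val_cons letter_val_inv mulVKg.
move=> szw /word_over_cat[Su /word_over_cons[_ /word_over_cons[_ Sv]]].
rewrite word_val_cat llv -word_val_cat => uv1.
have <- : crossings e x (u ++ v) = crossings e x (u ++ l :: letter_inv l :: v).
  rewrite !crossings_cat; congr (_ (+) _); rewrite /crossings /= edge_at_inv.
  by rewrite letter_val_inv mulgK addnA addnn oddD odd_double.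
apply: IH uv1; [|reflexivity|exact/word_over_cat].
by rewrite -szw !size_cat /= !addnS ltnS leqnSn.
Qed.

Lemma sep_crossings e x w :
  word_over S w -> sep e x (x * word_val w) = crossings e x w.
Proof.
move=> Sw; set y := x * _; pose loop := word_of x ++ w ++ word_inv (word_of y).
have : crossings e 1 loop = false.
  apply: crossings_loop; last first.
    by rewrite !word_val_cat word_val_inv !word_ofK mulgA mulgV.
  apply/word_over_cat; split; first exact: word_of_over.
  by apply/word_over_cat; split=> //; apply: word_over_inv; exact: word_of_over.
rewrite !crossings_cat word_ofK mul1g -/y.
have := crossings_inv e 1 (word_of y); rewrite mul1g word_ofK => ->.
rewrite /sep /side; move: (crossings e 1 _) (crossings e x _) (crossings e 1 _).
by case=> [] [] [].
Qed.

Lemma sep_word e x y : sep e x y = crossings e x (word_of (x^-1 * y)).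
Proof. by rewrite -sep_crossings ?word_ofK ?mulVKg //; apply: word_of_over. Qed.

Lemma sep_act g e x y : sep (edge_act g e) (g * x) (g * y) = sep e x y.
Proof. by rewrite !sep_word invgM mulgA mulgVK crossings_act. Qed.

Lemma sep_edge e x s : S s -> sep e x (x * s) = (e == (x, s)).
Proof.
move=> Ss; have := @sep_crossings e x [:: (s, false)].
rewrite word_val_cons word_val_nil mulg1 /letter_val /= => ->.
  by rewrite /crossings /= addn0 oddb eq_sym.
exact/word_over_cons.
Qed.

Lemma sep_finite x y : exists r : seq (G * G), forall e, sep e x y -> e \in r.
Proof.
exists (walk x (word_of (x^-1 * y))) => e; rewrite sep_word /crossings => oe.
by rewrite -has_pred1 has_count; case: (count _ _) oe.
Qed.

Lemma sep_basis e x y : sep e x y -> S e.2.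
Proof.
rewrite sep_word; move: (word_of _) (@word_of_over (x^-1 * y)) => w Sw oe.
have {oe}: e \in walk x w.
  by move: oe; rewrite /crossings -has_pred1 has_count; case: (count _ _).
elim: w {y}x Sw => [//|l w IH] z /word_over_cons[Sl Sw] /=.
rewrite inE => /orP[/eqP->|]; last exact: IH.
by rewrite /edge_at; case: l.2.
Qed.

Lemma sep_constant (c : G -> bool) x y :
  (forall e, sep e x y -> c e.1 = c (e.1 * e.2)) -> c x = c y.
Proof.
move=> ce; rewrite (@walk_constant _ c x (word_of (x^-1 * y))).
  by rewrite word_ofK mulVKg.
by move=> e; rewrite -sep_word; apply: ce.
Qed.

Lemma sep_neq x y : x <> y -> exists e, sep e x y.
Proof.
move=> xy; apply: contrapT => nsep; apply: xy.
have := @sep_constant (pred1 x) x y _; rewrite /= eqxx => /(_ _)/esym/eqP -> //.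
by move=> e sxy; case: nsep; exists e.
Qed.

Lemma potential1 f : potential f 1 = false.
Proof.
rewrite /potential sum_addb_parity big1_seq // => e _.
by have := @crossings_loop e 1 _ (@word_of_over 1) (word_ofK 1); rewrite /crossings => ->.
Qed.

Lemma potential_edge f x s :
  S s -> potential f (x * s) = potential f x (+) f (x, s).
Proof.
move=> Ss; pose w := word_of x ++ (s, false) :: word_inv (word_of (x * s)).
have Sw : word_over S w.
  apply/word_over_cat; split; first exact: word_of_over.
  by apply/word_over_cons; split=> //; apply: word_over_inv; exact: word_of_over.
have w1 : word_val w = 1.
  by rewrite word_val_cat word_val_cons word_val_inv !word_ofK mulgA mulgV.
have : \big[addb/false]_(e <- walk 1 w) f e = false.
  rewrite sum_addb_parity big1_seq // => e _.
  by have := crossings_loop e 1 Sw w1; rewrite /crossings => ->.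
rewrite walk_cat big_cat /= mul1g word_ofK big_cons.
have := walk_inv 1 (word_of (x * s)); rewrite mul1g word_ofK => ->.
rewrite (perm_big _ (permEl (perm_rev _))) /= -!/(potential _ _).
by case: (potential f x); case: (f _); case: (potential f _).
Qed.

End Separation.

(** * Left-invariant total orders on free groups *)

Definition strict_total (T : eqType) (lt : rel T) :=
  [/\ irreflexive lt, transitive lt & forall x y, x != y -> lt x y || lt y x].

(** The well-ordering principle only provides unique least elements of nonempty sets; totality,
    antisymmetry and transitivity are read off from sets of at most three elements. *)
Lemma strict_total_order_exists (T : eqType) : exists lt : rel T, strict_total lt.
Proof.
have [R woR] := well_ordering_principle T.
have minR (s : seq T) : s <> [::] -> exists2 z, z \in s & {in s, forall x, R z x}.
  case: s => [//|x s] _; have [|z [[zs Rz] _]] := woR [mem x :: s].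
    by exists x; apply: mem_head.
  by exists z.
have Rtot x y : R x y || R y x.
  have [//|z] := minR [:: x; y]; rewrite !inE => /orP[]/eqP-> Rz.
    by rewrite Rz // !inE eqxx orbT.
  by rewrite orbC Rz // mem_head.
have Ranti x y : R x y -> R y x -> x = y.
  have Rxx z : R z z by rewrite -[R z z]orbb Rtot.
  move=> Rxy Ryx; have [|z [_ Uz]] := woR [mem [:: x; y]].
    by exists x; apply: mem_head.
  by rewrite -(Uz x) ?(Uz y) //; split; rewrite ?inE ?eqxx ?orbT // => t;
     rewrite !inE => /orP[]/eqP->.
exists (fun x y => ~~ R y x); split=> [x|y x z Ryx Rzy|x y].
- by rewrite -[R x x]orbb Rtot.
- apply/negP => Rzx; have [//|t] := minR [:: x; y; z].
  rewrite !inE => /or3P[]/eqP-> Rt.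
  + have := Rtot y z; rewrite (negPf Rzy) orbF => Ryz.
    have xz : x = z by apply: Ranti => //; apply: Rt; rewrite !inE eqxx !orbT.
    by move: Ryx; rewrite xz Ryz.
  + by move: Ryx; rewrite Rt // mem_head.
  + by move: Rzy; rewrite Rt // !inE eqxx orbT.
- move=> xy; rewrite -negb_and; apply: contra_neqN xy => /andP[Ryx Rxy]; exact: Ranti.
Qed.

(** * Reduced words and normal forms *)

Section ReducedWords.
Variables (G : groupType).
Implicit Types (x y z g : G) (l m : G * bool) (c u v w : seq (G * bool)).

Lemma word_invK : involutive (@word_inv G).
Proof.
move=> w; rewrite /word_inv map_rev revK -map_comp map_id_in // => l _.
exact: letter_invK.
Qed.

Lemma word_inv_cat u v : word_inv (u ++ v) = word_inv v ++ word_inv u.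
Proof. by rewrite /word_inv map_cat rev_cat. Qed.

Lemma word_inv_cons l w : word_inv (l :: w) = rcons (word_inv w) (letter_inv l).
Proof. by rewrite /word_inv /= rev_cons. Qed.

Lemma reduced_cat u l m v :
  reduced (rcons u l) -> reduced (m :: v) -> m != letter_inv l ->
  reduced (rcons u l ++ m :: v).
Proof.
rewrite /reduced; case: u => [|k u] /=; rewrite ?inverse_lettersE.
  by move=> _ -> ->.
by rewrite cat_path last_rcons /= inverse_lettersE => -> -> ->.
Qed.

Lemma reduced_cat2 u v : reduced (u ++ v) -> reduced u /\ reduced v.
Proof. by move/[dup]/cat_sorted2; case. Qed.

Lemma reduced_rev u : reduced u -> reduced (word_inv u).
Proof.
rewrite /reduced /word_inv rev_sorted sorted_map; apply: sub_sorted => l m /=.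
by rewrite !inverse_lettersE letter_invK eq_sym.
Qed.

Lemma reduced_product u v : reduced u -> reduced v ->
  exists u' c v', [/\ u = u' ++ c, v = word_inv c ++ v' & reduced (u' ++ v')].
Proof.
elim/last_ind: u v => [|u l IH] v ru rv; first by exists [::], [::], v.
case: v rv => [|m v] rv; first by exists (rcons u l), [::], [::]; rewrite !cats0.
have [ml | ml] := eqVneq m (letter_inv l); last first.
  by exists (rcons u l), [::], (m :: v); rewrite cats0; split=> //; apply: reduced_cat.
have [|| u' [c [v' [-> -> ruv]]]] := IH v.
- by move: ru; rewrite -cats1 => /reduced_cat2[].
- by move: rv; rewrite -cat1s => /reduced_cat2[].
exists u', (rcons c l), v'; split=> //; first by rewrite rcons_cat.
by rewrite ml /word_inv map_rcons rev_rcons.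
Qed.

Lemma reduced_exists S w : word_over S w ->
  exists v : seq (G * bool), [/\ word_over S v, reduced v & word_val v = word_val w].
Proof.
elim: w => [|l w IH]; first by exists [::].
case/word_over_cons=> Sl /IH[[|m v] [Sv rv vw]].
  by exists [:: l]; split=> //; rewrite ?word_val_cons ?vw //; apply/word_over_cons.
have [ml | ml] := eqVneq m (letter_inv l).
  exists v; split; first by case/word_over_cons: Sv.
    by move: rv; rewrite -cat1s => /reduced_cat2[].
  by rewrite word_val_cons -vw word_val_cons ml letter_val_inv mulVKg.
exists [:: l, m & v]; split; first by apply/word_over_cons.
  exact: (@reduced_cat [::] l).
by rewrite word_val_cons vw -word_val_cons.
Qed.

(** Cancelling [u] against [word_inv v] leaves a reduced word of value 1, which freeness forces to
    be empty; so all of [u] cancels against all of [word_inv v]. *)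
Lemma reduced_unique S u v : free_basis S [set: G] ->
  word_over S u -> word_over S v -> reduced u -> reduced v ->
  word_val u = word_val v -> u = v.
Proof.
move=> [_ freeS] Su Sv ru rv uv.
have [u' [c [v' [def_u def_v ruv]]]] := reduced_product ru (reduced_rev rv).
have /word_over_cat[Su' _] : word_over S (u' ++ c) by rewrite -def_u.
have /word_over_cat[_ Sv'] : word_over S (word_inv c ++ v').
  by rewrite -def_v; apply: word_over_inv.
have uv0 : u' ++ v' = [::].
  apply: contrapT => /(freeS _ _ ruv); apply; first exact/word_over_cat.
  have : word_val (u ++ word_inv v) = 1 by rewrite word_val_cat word_val_inv uv mulgV.
  by rewrite def_u def_v !word_val_cat word_val_inv !mulgA mulgK.
have [u0 v0] : u' = [::] /\ v' = [::] by case: (u') (v') uv0 => [|? ?] [|? ?].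
by rewrite -[v]word_invK def_v v0 cats0 word_invK def_u u0.
Qed.

End ReducedWords.

(** * A height function on words *)

Section Heights.
Local Open Scope ring_scope.
Variables (G : groupType) (lt_letter : rel (G * bool)).
Hypothesis lt_letterP : strict_total lt_letter.
Implicit Types (l m n : G * bool) (c u v w : seq (G * bool)).

Definition turn_sign l m : int :=
  if l == m then 0 else if lt_letter l m then 1 else -1.

Definition letter_sign l : int := if l.2 then -1 else 1.

(** At the vertex where [v] is appended to [u], the direction back along [u] is compared with the
    direction onward along [v]. *)
Definition turn u v : int :=
  if u is l :: u' then
    if v is m :: _ then turn_sign (letter_inv (last l u')) m else 0
  else 0.

Fixpoint word_height w : int :=
  if w is l :: w' then letter_sign l + turn [:: l] w' + word_height w' else 0.

Lemma turn_sign_trichotomy l m : l != m ->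
  turn_sign l m = 1 /\ lt_letter l m /\ ~~ lt_letter m l \/
  turn_sign l m = -1 /\ ~~ lt_letter l m /\ lt_letter m l.
Proof.
have [irr tr tot] := lt_letterP => lm; rewrite /turn_sign (negPf lm).
have := tot l m lm; have := tr m l l; rewrite irr.
case: (lt_letter l m); case: (lt_letter m l) => //=; first by move/(_ isT isT).
  by left.
by right.
Qed.

Lemma turn_signC l m : turn_sign l m = - turn_sign m l.
Proof.
have [-> | lm] := eqVneq l m; first by rewrite /turn_sign eqxx.
have ml : m != l by rewrite eq_sym.
case: (turn_sign_trichotomy lm) => [[-> [_ nml]] | [-> [nlm _]]];
case: (turn_sign_trichotomy ml) => [[-> [ml1 nl]] | [-> [nm lm1]]] //.
- by rewrite ml1 in nml.
- by rewrite lm1 in nlm.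
Qed.

(** Three equal nonzero signs would be a cycle of the strict order. If two of the directions
    coincide, one sign is 0 and the other two cancel. *)
Lemma turn_sign_tripod l m n :
  `|turn_sign l m + turn_sign m n + turn_sign n l| <= 1.
Proof.
have [irr tr tot] := lt_letterP.
have [-> | lm] := eqVneq l m.
  by rewrite [turn_sign n m]turn_signC /turn_sign eqxx; lia.
have [-> | mn] := eqVneq m n.
  by rewrite [turn_sign n l]turn_signC /turn_sign eqxx; lia.
have [-> | nl] := eqVneq n l.
  by rewrite [turn_sign m l]turn_signC /turn_sign eqxx; lia.
have lmn := tr m l n; have nml := tr m n l.
case: (turn_sign_trichotomy lm) => [] [-> [lm1 ml1]];
case: (turn_sign_trichotomy mn) => [] [-> [mn1 nm1]];
case: (turn_sign_trichotomy nl) => [] [-> [nl1 ln1]] //; lia.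
Qed.

Lemma turn_rcons u l m v :
  turn (rcons u l) (m :: v) = turn_sign (letter_inv l) m.
Proof. by case: u => //= k u; rewrite last_rcons. Qed.

Lemma word_height_cat u v :
  word_height (u ++ v) = word_height u + turn u v + word_height v.
Proof.
elim: u => [|l u IH] /=; first by lia.
by rewrite IH; case: u {IH} => [|m u]; case: v => [|n v] /=; lia.
Qed.

Lemma word_height_inv w : word_height (word_inv w) = - word_height w.
Proof.
elim: w => [|l w IH]; first by [].
rewrite -cat1s word_inv_cat !word_height_cat IH.
have -> : turn (word_inv w) (word_inv [:: l]) = - turn [:: l] w.
  case: w {IH} => [|m w]; first by [].
  by rewrite !word_inv_cons turn_rcons letter_invK /= -turn_signC.
by rewrite /word_inv /= /letter_sign; case: l => s [] /=; lia.
Qed.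

(** A reduced word of n letters has n letter signs and n - 1 turn signs. No turn sign is 0, because
    the path never turns back, so 2n - 1 odd terms are added. *)
Lemma word_height_odd w : reduced w -> w <> [::] ->
  exists k : int, word_height w = k *+ 2 + 1.
Proof.
elim: w => [//|l [|m w] IH] rw _.
  by rewrite /= /letter_sign; case: l.2; [exists (-1)|exists 0].
have [k hk] : exists k : int, word_height (m :: w) = k *+ 2 + 1.
  by apply: IH => //; move: rw; rewrite -cat1s => /reduced_cat2[].
have lm : letter_inv l != m.
  by move: rw; rewrite /reduced /= inverse_lettersE eq_sym => /andP[].
rewrite -cat1s word_height_cat hk /= /letter_sign.
case: (turn_sign_trichotomy lm) => [] [-> _]; case: l.2.
- by exists k; lia.
- by exists (k + 1); lia.
- by exists (k - 1); lia.
- by exists k; lia.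
Qed.

(** The heights of [u], [v] and [c] cancel, leaving the turns at the point where the three arms
    meet. They form a tripod, or at most one is nonzero if an arm is empty. *)
Lemma word_height_product u v c :
  `|word_height (u ++ v) - word_height (u ++ c)
    - word_height (word_inv c ++ v)| <= 1.
Proof.
rewrite !word_height_cat word_height_inv.
set d := (X in `|X|); have -> : d = turn u v - turn u c - turn (word_inv c) v.
  by rewrite /d; lia.
have turn_le w w' : `|turn w w'| <= 1.
  by case: w w' => [|l w] [|m w'] //=; rewrite /turn_sign; do 2?case: ifP.
have turn0 w : turn w [::] = 0 by case: w.
clear d; case: c => [|m c].
  by rewrite turn0 /=; have := turn_le u v; lia.
case/lastP: u => [|u l]; first by rewrite /=; have := turn_le (word_inv (m :: c)) v; lia.
case: v => [|n v]; first by rewrite !turn0; have := turn_le (rcons u l) (m :: c); lia.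
rewrite word_inv_cons !turn_rcons letter_invK; set k := letter_inv l.
by have := turn_sign_tripod k m n; rewrite [turn_sign n k]turn_signC; lia.
Qed.

End Heights.

(* The cone of elements of positive height is a positive cone because height is
   odd off the identity, is negated by inversion, and is additive up to an error
   of at most 1: the error is the sum of the turn signs around the branching
   point of a tripod. *)
Lemma left_order_exists (G : groupType) (S : set G) : free_basis S [set: G] ->
  exists2 lt : rel G, strict_total lt & forall g x y, lt (g * x) (g * y) = lt x y.
Proof.
move=> freeS; have [lt ltP] := strict_total_order_exists (G * bool)%type.
have /choice[red redP] x : exists w, [/\ word_over S w, reduced w & word_val w = x].
  by have [w [? ? ?]] := reduced_exists (@word_of_over _ _ freeS x); exists w;
     split=> //; rewrite -(word_ofK freeS x).
pose height x := word_height lt (red x).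
have redE x w : word_over S w -> reduced w -> word_val w = x -> red x = w.
  have [Sx rx vx] := redP x => Sw rw vw.
  by apply: (reduced_unique freeS) => //; rewrite vx.
have heightV x : height x^-1 = (- height x)%R.
  have [Sx rx vx] := redP x; rewrite -(word_height_inv ltP); congr word_height.
  apply: redE; [exact: word_over_inv|exact: reduced_rev|].
  by rewrite word_val_inv vx.
have heightM x y : (`|height (x * y)%g - height x - height y| <= 1)%R.
  have [Sx rx vx] := redP x; have [Sy ry vy] := redP y.
  have [u [c [v [xE yE ruv]]]] := reduced_product rx ry.
  rewrite /height xE yE; have -> : red (x * y) = u ++ v.
    move: Sx Sy vx vy; rewrite xE yE => /word_over_cat[Su _] /word_over_cat[_ Sv].
    move=> vx vy; apply: redE => //; first exact/word_over_cat.
    by rewrite -vx -vy !word_val_cat word_val_inv !mulgA mulgK.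
  exact: word_height_product.
have height_odd x : x != 1 -> exists k : int, height x = (k *+ 2 + 1)%R.
  have [Sx rx vx] := redP x => x1; apply: word_height_odd => // red0.
  by move: x1; rewrite -vx red0 word_val_nil eqxx.
have height1 : height 1 = 0%R.
  by have := heightV 1; rewrite invg1; move: (height 1); lia.
exists (fun x y => 0 < height (x^-1 * y)%g)%R => [|g x y]; last first.
  by rewrite invgM !mulgA mulgVK.
split=> [x|y x z|x y xy]; first by rewrite mulVg height1.
  (* Positive heights are at least 1, so an error of at most 1 leaves the height of the product
     positive. *)
  have := heightM (x^-1 * y) (y^-1 * z); rewrite mulgA mulgK => h hxy hyz.
  move: h hxy hyz; have [-> | /height_odd[k ->]] := eqVneq (x^-1 * z) 1.
    by rewrite height1; move: (height _) (height _); lia.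
  by move: (height _) (height _); lia.
have -> : y^-1 * x = (x^-1 * y)^-1 by rewrite invgM invgK.
rewrite heightV; have [|k ->] := height_odd (x^-1 * y); last by lia.
by apply: contraNneq xy => E; rewrite -[y](mulVKg x) E mulg1.
Qed.

Definition edge_lt (G : groupType) (lt : rel G) (e f : G * G) :=
  lt e.1 f.1 || (e.1 == f.1) && lt e.2 f.2.

Lemma edge_ltP (G : groupType) (lt : rel G) :
  strict_total lt -> strict_total (edge_lt lt).
Proof.
case=> irr tr tot; split=> [[x s]|[y t] [x s] [z u]|[x s] [y t]];
  rewrite /edge_lt /=.
- by rewrite !irr andbF.
- case/orP=> [xy|/andP[/eqP-> st]] /orP[yz|/andP[/eqP zE tu]].
  + by rewrite (tr y x z).
  + by rewrite -zE xy.
  + by rewrite yz.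
  + by rewrite zE eqxx (tr t s u) ?orbT.
- rewrite xpair_eqE negb_and; have [-> /= | /tot] := eqVneq x y.
    by rewrite irr => /tot.
  by case/orP=> ->; rewrite ?orbT.
Qed.

Lemma edge_lt_act (G : groupType) (lt : rel G) g e f :
  (forall g x y, lt (g * x) (g * y) = lt x y) ->
  edge_lt lt (edge_act g e) (edge_act g f) = edge_lt lt e f.
Proof. by move=> ltM; rewrite /edge_lt /= ltM (inj_eq (@mulgI _ g)). Qed.

(** * Freeness criterion and orbits *)

Lemma walkP (G : groupType) e (x : G) w : e \in walk x w ->
  exists u m v, w = u ++ m :: v /\ e = edge_at (x * word_val u) m.
Proof.
elim: w x => [//|l w IH] x /=; rewrite inE => /orP[/eqP->|/IH].
  by exists [::], l, w; rewrite word_val_nil mulg1.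
case=> u [m [v [-> ->]]]; exists (l :: u), m, v.
by rewrite word_val_cons mulgA.
Qed.

(* q is a Fox derivative modulo 2.  In a shortest nontrivial relation the first
   edge is crossed a second time, and the portion in between is a shorter
   relation. *)
Lemma free_of_crossing (G : groupType) (L Y : set G) (q : G -> G * G -> bool) :
    is_subgroup L -> Y `<=` L ->
    (forall z x y y', L z -> L x -> Y y -> Y y' ->
       q (z * y) (x, y') = q z (x, y') (+) ((x, y') == (z, y))) ->
  forall w, word_over Y w -> reduced w -> w <> [::] -> word_val w <> 1.
Proof.
move=> gL YL qP.
have Lval l : Y l.1 -> L (letter_val l).
  by move=> /YL Ll; rewrite /letter_val; case: l.2 => //; apply: (subgroupV gL).
(* Along a walk in [L], [q] changes by the parity of crossings; a closed walk therefore crosses each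
   such edge an even number of times. *)
have q_crossings x e w : L x -> L e.1 -> Y e.2 -> word_over Y w ->
    q (x * word_val w) e = q x e (+) crossings e x w.
  move=> + Le Ye; elim: w x => [|l w IH] x Lx Yw.
    by rewrite word_val_nil mulg1 addbF.
  case/word_over_cons: Yw => Yl Yw; have Lxl := subgroupM gL Lx (Lval _ Yl).
  rewrite word_val_cons mulgA IH // -cat1s crossings_cat addbA; congr (_ (+) _).
    rewrite /crossings /= addn0 oddb eq_sym; case: l e Le Ye {IH} Yl Lxl => [y b] [z y'].
    rewrite /edge_at /letter_val /=; case: b => /= Lz Yy' Yy Lxl; last exact: qP.
    by rewrite -{2}(mulgVK y x) qP // addbK.
  by rewrite word_val_cons word_val_nil mulg1.
move=> w; have [n] := ubnP (size w); elim: n w => // n IH [//|l w] szw Yw rw _ w1.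
case/word_over_cons: (Yw) => Yl Yw'.
have : edge_at 1 l \in walk (letter_val l) w.
  have := @q_crossings 1 (edge_at 1 l) (l :: w) (subgroup1 gL) _ _ Yw.
  rewrite w1 mulg1 /crossings /= eqxx mul1g.
  rewrite -has_pred1 has_count.
  case: (count _ _) => //=; rewrite addbT => h.
  suff: q 1 (edge_at 1 l) = ~~ q 1 (edge_at 1 l) by case: (q _ _).
  apply: h; last by rewrite /edge_at; case: l.2.
  have := Lval l Yl; rewrite /edge_at /letter_val; case: l.2; rewrite ?mul1g //= => _.
  exact: subgroup1 gL.
case/walkP=> u [m [v [def_w]]]; rewrite -word_val_cons => em.

have short : word_val (l :: u) = 1 -> False.
  apply: IH => //; first by move: szw; rewrite def_w /= size_cat /=; lia.
    by move: Yw; rewrite def_w -cat_cons => /word_over_cat[].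
  by move: rw; rewrite def_w -cat_cons => /reduced_cat2[].
(* If the second crossing has the same direction, [l :: u] is a shorter relation. If it has the
   opposite one, [u] is a shorter relation, hence empty, and [l] cancels against [m]. *)
have [ml | ml] : m = l \/ m = letter_inv l.
  move: em; case: l m {IH szw Yw rw w1 Yl def_w short} => [y b] [y' b'].
  by case: b; case: b'; rewrite /edge_at /letter_inv /= => -[_ ->]; auto.
- apply: short; move: em; rewrite ml /edge_at; case: l.2 => -[]; last by [].
  by rewrite mul1g => /esym/(canRL (mulgVK _)); rewrite mulVg.
- have {}em : word_val u = 1.
    have : edge_at (letter_val l) (letter_inv l) = edge_at (word_val (l :: u)) m.
      by rewrite -em -[letter_val l]mul1g edge_at_inv.
    rewrite ml word_val_cons /edge_at; case: ifP => _ [] /esym.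
      by move/mulIg/(canRL (mulKg _)); rewrite mulVg.
    by move/(canRL (mulKg _)); rewrite mulVg.
  have u0 : u = [::].
    apply: contrapT => u0; apply: IH em => //.
    + by move: szw; rewrite def_w /= size_cat /=; lia.
    + by move: Yw'; rewrite def_w => /word_over_cat[].
    + by move: rw; rewrite def_w -cat1s catA => /reduced_cat2[+ _] => /reduced_cat2[].
  by move: rw; rewrite def_w u0 ml /reduced /= inverse_lettersE eqxx.
Qed.

Section Orbits.
Variables (G : groupType) (T : choiceType) (act : G -> T -> T).
Hypothesis act1 : forall t, act 1 t = t.
Hypothesis actM : forall g g' t, act (g * g') t = act g (act g' t).
Implicit Types (H K : set G) (A B : set T) (D r : seq T) (g : G) (t d : T).

Definition same_orbit H t t' := exists2 g, H g & t' = act g t.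

Definition transversal_of H A D :=
  [/\ uniq D, forall d, d \in D -> A d,
      forall t, A t -> exists2 d, d \in D & same_orbit H d t
    & forall d d', d \in D -> d' \in D -> same_orbit H d d' -> d = d'].

Lemma same_orbit_refl H t : is_subgroup H -> same_orbit H t t.
Proof. by move=> gH; exists 1; rewrite ?act1 //; exact: subgroup1 gH. Qed.

Lemma same_orbit_sym H t t' : is_subgroup H -> same_orbit H t t' -> same_orbit H t' t.
Proof.
move=> gH [g Hg ->]; exists g^-1; first exact: subgroupV gH Hg.
by rewrite -actM mulVg act1.
Qed.

Lemma same_orbit_trans H t t' t'' : is_subgroup H ->
  same_orbit H t t' -> same_orbit H t' t'' -> same_orbit H t t''.
Proof.
move=> gH [g Hg ->] [g' Hg' ->]; exists (g' * g); first exact: subgroupM gH Hg' Hg.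
by rewrite actM.
Qed.

(** The list [r] may repeat orbits and leave [A]. Each of its members is replaced by a point of [A]
    in the same orbit, if there is one, and that orbit is removed before continuing. *)
Lemma transversal_exists H A r : is_subgroup H ->
  (forall t, A t -> exists2 d, d \in r & same_orbit H d t) ->
  exists D, transversal_of H A D.
Proof.
move=> gH; elim: r A => [|d r IH] A Ar.
  by exists [::]; split=> // t /Ar[].
pose A' := [set t | A t /\ ~ same_orbit H d t].
have [D [uD DA' A'D rD]] : exists D, transversal_of H A' D.
  apply: IH => t [At ndt]; have [d'] := Ar t At; rewrite inE => /orP[/eqP->|] //.
  by exists d'.
have [[t0 At0 dt0] | noA] := pselect (exists2 t0, A t0 & same_orbit H d t0); last first.
  exists D; split=> // [d' /DA'[]|t At] //; apply: A'D; split=> // dt.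
  by apply: noA; exists t.
have nD t : t \in D -> ~ same_orbit H t0 t.
  by move=> /DA'[_ ndt] t0t; apply: ndt; apply: same_orbit_trans t0t.
exists (t0 :: D); split=> /=.
- rewrite uD andbT; apply/negP => /nD; apply; exact: same_orbit_refl.
- by move=> d'; rewrite inE => /orP[/eqP->|/DA'[]].
- move=> t At; have [dt | ndt] := pselect (same_orbit H d t).
    exists t0; rewrite ?mem_head //.
    by apply: same_orbit_trans dt => //; apply: same_orbit_sym.
  by have [|d' d'D d't] := A'D t; [split|exists d'; rewrite // inE d'D orbT].
- move=> d1 d2; rewrite !inE => /orP[/eqP->|d1D] /orP[/eqP->|d2D] //; last exact: rD.
    by move=> /nD.
  by move/(same_orbit_sym gH)/nD.
Qed.

Hypothesis act_free : forall g t, act g t = t -> g = 1.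

(** The part of [A] in the meet of an [H]-orbit and a [K]-orbit lies in one orbit of the
    intersection: by freeness the element moving one point to another is unique, so it belongs to
    both subgroups. *)
Lemma orbitsI H K A (rH rK : seq T) : is_subgroup H -> is_subgroup K ->
    (forall t, A t -> exists2 d, d \in rH & same_orbit H d t) ->
    (forall t, A t -> exists2 d, d \in rK & same_orbit K d t) ->
  exists r, forall t, A t -> exists2 d, d \in r & same_orbit (H `&` K) d t.
Proof.
move=> gH gK AH AK.
pose meet p := [set t | [/\ A t, same_orbit H p.1 t & same_orbit K p.2 t]].
(* The default [p.1] for an empty meet is harmless, since only nonempty meets are looked up. *)
exists [seq xget p.1 (meet p) | p <- allpairs pair rH rK] => t At.
have [d dH dt] := AH t At; have [d' dK d't] := AK t At.
exists (xget d (meet (d, d'))).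
  by apply/mapP; exists (d, d') => //; apply: allpairs_f.
have [|_ [g Hg E] [k Kk E']] := @xgetPex _ d (meet (d, d')); first by exists t.
have {dt} [g' Hg' dt] := dt; have {d't} [k' Kk' d't] := d't.
set x := xget _ _ in E E' *; exists (g' * g^-1); last first.
  by rewrite E -actM mulgVK.
split; first by apply: (subgroupM gH) => //; apply: (subgroupV gH).
suff -> : g' * g^-1 = k' * k^-1 by apply: (subgroupM gK) => //; apply: (subgroupV gK).
apply/eqP; rewrite -divg_eq1; apply/eqP; apply: (act_free (t := t)).
rewrite invgM invgK actM.
have -> : act (k * k'^-1) t = x by rewrite d't -actM mulgVK -E'.
by rewrite E -actM mulgVK -dt.
Qed.

End Orbits.

(** A pigeonhole principle for a matching given as a relation, so that no function has to be chosen.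
    A match of the head is removed from [F] before the induction. *)
Lemma rel_leq_size (T T' : eqType) (R : T -> T' -> Prop) (D : seq T) (F : seq T') :
    uniq D -> (forall x, x \in D -> exists2 y, y \in F & R x y) ->
    (forall x x' y, x \in D -> x' \in D -> y \in F -> R x y -> R x' y -> x = x') ->
  (size D <= size F)%N.
Proof.
elim: D F => [//|x D IH] F /= /andP[xD uD] RF inj.
have [y yF Rxy] := RF x (mem_head _ _).
have /IH/(_ _) szD : uniq D by [].
have -> : size F = (size (rem y F)).+1.
  by rewrite size_rem //; case: (F) yF.
rewrite ltnS; apply: IH => // [x' x'D | x1 x2 y' x1D x2D y'F].
  have [|y' y'F Rx'y'] := RF x'; first by rewrite inE x'D orbT.
  exists y' => //; have [y'y | /negP ny'y] := eqVneq y' y; last first.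
    apply: contraT => y'R; case: ny'y; move: y'F.
    by rewrite (perm_mem (perm_to_rem yF)) inE (negPf y'R) orbF.
  case/negP: xD; rewrite (inj x x' y) ?mem_head // ?inE ?x'D ?orbT //.
  by rewrite -y'y.
by apply: inj; rewrite ?inE ?x1D ?x2D ?orbT // (mem_rem y'F).
Qed.

(** * Balls and bridges *)

Lemma strict_total_flip (T : eqType) (lt : rel T) :
  strict_total lt -> strict_total (fun x y => lt y x).
Proof.
case=> irr tr tot; split=> [x|y x z yx zy|x y xy]; first exact: irr.
  exact: tr zy yx.
by rewrite orbC; apply: tot.
Qed.

Lemma seq_min (T : eqType) (lt : rel T) (s : seq T) : strict_total lt ->
  s <> [::] -> exists2 m, m \in s & {in s, forall x, x = m \/ lt m x}.
Proof.
case=> irr tr tot; elim: s => [//|x [|y s] IH] _.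
  by exists x; rewrite ?mem_head // => z; rewrite inE => /eqP; left.
have [//|m ms mP] := IH; have [E | /tot/orP[xm | mx]] := eqVneq x m.
- exists x; rewrite ?mem_head // => z; rewrite inE => /orP[/eqP|]; first by left.
  by rewrite E; apply: mP.
- exists x; rewrite ?mem_head // => z; rewrite inE => /orP[/eqP|]; first by left.
  by case/mP=> [->|/(tr _ _ _ xm)]; right.
- exists m; first by rewrite inE ms orbT.
  by move=> z; rewrite inE => /orP[/eqP->|/mP] //; right.
Qed.

Lemma set_min (T : choiceType) (lt : rel T) (A : set T) : strict_total lt ->
  finite_set A -> A !=set0 -> exists2 m, A m & forall x, A x -> ~~ lt x m.
Proof.
move=> ltP /finite_seqP[s ->] [x xs]; have [|m ms mP] := seq_min ltP (s := s).
  by move=> s0; rewrite s0 in xs.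
exists m => // y /mP[->|my]; have [irr tr _] := ltP; first by rewrite irr.
by apply/negP => /(tr _ _ _ my); rewrite irr.
Qed.

Lemma injective_infinite (T : choiceType) (A : set T) (f : nat -> T) :
  injective f -> (forall n, A (f n)) -> infinite_set A.
Proof.
move=> f_inj Af /finite_seqP[s As].
have : (size (map f (iota 0 (size s).+1)) <= size s)%N.
  apply: uniq_leq_size; first by rewrite map_inj_uniq ?iota_uniq.
  by move=> _ /mapP[n _ ->]; have := Af n; rewrite As.
by rewrite size_map size_iota ltnn.
Qed.

Section Balls.
Variables (G : groupType) (S : set G) (lt : rel G).
Hypotheses (freeS : free_basis S [set: G]) (ltP : strict_total lt).
Hypothesis lt_act : forall g x y, lt (g * x) (g * y) = lt x y.
Implicit Types (x y z g u v w : G) (e f : G * G) (b c : bool) (H V U : set G).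

Local Notation sep := (sep S).
Local Notation elt := (edge_lt lt).

Let eltP : strict_total elt := edge_ltP ltP.

Lemma elt_irr e : elt e e = false.
Proof. by case: eltP => irr _ _; apply: irr. Qed.

Lemma elt_trans f e e' : elt e f -> elt f e' -> elt e e'.
Proof. by case: eltP => _ tr _; apply: tr. Qed.

Lemma elt_total e f : e <> f -> elt e f \/ elt f e.
Proof. by case: eltP => _ _ tot /eqP/tot/orP. Qed.

Lemma elt_act g e f : elt (edge_act g e) (edge_act g f) = elt e f.
Proof. exact: edge_lt_act. Qed.

Lemma torsion_free g n : g != 1 -> g ^+ n.+1 != 1.
Proof.
have [irr tr tot] := ltP.
have pos h : lt 1 h -> lt 1 (h ^+ n.+1).
  move=> h1; elim: n => [|n IH]; first by rewrite expg1.
  by apply: tr h1 _; rewrite expgS -{1}[h]mulg1 lt_act.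
move/tot/orP=> [g1 | /pos].
  have /pos : lt 1 g^-1 by rewrite -(lt_act g) mulg1 mulgV.
  by rewrite expVgn; apply: contraTneq => ->; rewrite invg1 irr.
by apply: contraTneq => ->; rewrite irr.
Qed.

Definition edge_end e b : G := if b then e.1 * e.2 else e.1.

Lemma edge_end_act g e b : edge_end (edge_act g e) b = g * edge_end e b.
Proof. by case: b; rewrite //= mulgA. Qed.

Lemma sep_edge_end e f b : S e.2 ->
  sep f (edge_end e b) (edge_end e (~~ b)) = (f == e).
Proof.
case: e b => x s [] Ss /=; last exact: sep_edge.
by rewrite sepC; apply: sep_edge.
Qed.

(** Subtrees are represented by their vertex sets, and [edges_of] recovers the edges. *)
Definition convex V := forall e x y, V x -> V y -> sep e x y ->
  forall b, V (edge_end e b).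

Definition edges_of V := [set e | S e.2 /\ forall b, V (edge_end e b)].

Definition stable_under H V := forall g v, H g -> V v -> V (g * v).

(* The component of the endpoint of e in the subtree V once the edges of V that
   are not smaller than e have been removed. *)
Definition ball V e b :=
  [set w | V w /\ forall f, sep f (edge_end e b) w -> elt f e].

Definition bridge V e := edges_of V e /\ forall b, infinite_set (ball V e b).

(* Each edge that is not a bridge belongs to the least vertex of a finite
   adjacent ball; if both balls are finite, the one with the larger least
   vertex is chosen. *)
Definition owner V e v := exists b, [/\ finite_set (ball V e b), ball V e b v,
  forall w, ball V e b w -> ~~ lt w v
  & finite_set (ball V e (~~ b)) -> exists2 w, ball V e (~~ b) w & lt w v].

Lemma convex_sep V e x y : convex V -> V x -> V y -> sep e x y -> edges_of V e.
Proof. by move=> cV Vx Vy exy; split=> [|b]; [apply: sep_basis exy|apply: cV exy b]. Qed.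

Lemma edges_of_act H V g e : stable_under H V -> H g -> edges_of V e ->
  edges_of V (edge_act g e).
Proof. by move=> iV Hg [Se Ve]; split=> // b; rewrite edge_end_act; apply: iV. Qed.

Lemma ball_center V e b : edges_of V e -> ball V e b (edge_end e b).
Proof. by case=> _ Ve; split=> // f; rewrite sepxx. Qed.

Lemma ball_sep V e b x y f : ball V e b x -> ball V e b y -> sep f x y -> elt f e.
Proof.
move=> [_ xe] [_ ye] /(sep_split (edge_end e b)) [|/ye //].
by rewrite sepC => /xe.
Qed.

Lemma ball_near V e b x y : ball V e b x -> V y ->
  (forall f, sep f x y -> elt f e) -> ball V e b y.
Proof. by move=> [_ xe] Vy xy; split=> // f /(sep_split x)[/xe|/xy]. Qed.

Lemma ball_sep_opp V e b x y f : edges_of V e ->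
  ball V e b x -> ball V e (~~ b) y -> sep f x y -> f = e \/ elt f e.
Proof.
move=> [Se _] [_ xe] [_ ye] /(sep_split (edge_end e b)) [|].
  by rewrite sepC => /xe; right.
case/(sep_split (edge_end e (~~ b))) => [|/ye]; last by right.
by rewrite sep_edge_end // => /eqP; left.
Qed.

Lemma ball_disjoint V e b x : edges_of V e ->
  ball V e b x -> ball V e (~~ b) x -> False.
Proof.
move=> [Se _] [_ xe] [_ xe'].
have : sep e (edge_end e b) (edge_end e (~~ b)) by rewrite sep_edge_end.
case/(sep_split x) => [/xe|]; first by rewrite elt_irr.
by rewrite sepC => /xe'; rewrite elt_irr.
Qed.

(** A path from [v] into either ball of [e] uses only [e] and smaller edges, all of them smaller
    than [e'], so it stays in the ball of [e']. *)
Lemma ball_nested V e e' b b' c v : edges_of V e -> elt e e' ->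
  ball V e b v -> ball V e' b' v -> ball V e c `<=` ball V e' b'.
Proof.
move=> Xe ee' vb vb' w wc; apply: (ball_near vb'); first by case: wc.
have [cb | cb] := eqVneq c b => f.
  by rewrite cb in wc => /(ball_sep vb wc) fe; apply: elt_trans fe ee'.
have {cb} cb : c = ~~ b by case: c b cb {vb wc} => [] [].
rewrite cb in wc => /(ball_sep_opp Xe vb wc)[-> //|fe]; exact: elt_trans fe ee'.
Qed.

Lemma ball_act H V g e b w : is_subgroup H -> stable_under H V -> H g ->
  ball V (edge_act g e) b (g * w) <-> ball V e b w.
Proof.
move=> gH iV Hg; rewrite /ball /= edge_end_act; split=> -[Vw we]; split.
- by rewrite -(mulKg g w); apply: iV => //; apply: (subgroupV gH).
- by move=> f; rewrite -(sep_act freeS g) => /we; rewrite elt_act.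
- exact: iV.
- move=> f; rewrite -(sep_act freeS g^-1) !mulKg => /we.
  by rewrite -(elt_act g) -edge_actM mulgV edge_act1.
Qed.

Lemma ball_actE H V g e b : is_subgroup H -> stable_under H V -> H g ->
  ball V (edge_act g e) b = [set g * w | w in ball V e b].
Proof.
move=> gH iV Hg; apply/seteqP; split=> [w|_ [w ew <-]]; last first.
  exact/(ball_act e b w gH iV Hg).
rewrite -{1}(mulVKg g w) => /(ball_act _ _ _ gH iV Hg) ew.
by exists (g^-1 * w); rewrite ?mulVKg.
Qed.

Lemma finite_ball_act H V g e b : is_subgroup H -> stable_under H V -> H g ->
  finite_set (ball V (edge_act g e) b) <-> finite_set (ball V e b).
Proof.
move=> gH iV Hg; split=> [|fe]; last first.
  by rewrite (ball_actE _ _ gH iV Hg); apply: finite_image.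
rewrite (ball_actE _ _ gH iV Hg) => /(finite_image (fun w => g^-1 * w)).
apply: sub_finite_set => w ew; exists (g * w); first by exists w.
by rewrite mulKg.
Qed.

Lemma bridge_act H V g e : is_subgroup H -> stable_under H V -> H g ->
  bridge V e -> bridge V (edge_act g e).
Proof.
move=> gH iV Hg [Xe infe]; split; first exact: edges_of_act iV Hg Xe.
by move=> b /(finite_ball_act _ _ gH iV Hg); apply: infe.
Qed.

Lemma owner_act H V g e v : is_subgroup H -> stable_under H V -> H g ->
  owner V e v -> owner V (edge_act g e) (g * v).
Proof.
move=> gH iV Hg [b [fb bv vmin vopp]]; exists b; split.
- exact/(finite_ball_act _ _ gH iV Hg).
- exact/(ball_act _ _ _ gH iV Hg).
- by move=> w; rewrite (ball_actE _ _ gH iV Hg) => -[w' /vmin + <-]; rewrite lt_act.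
- move=> /(finite_ball_act _ _ gH iV Hg)/vopp[w bw wv]; exists (g * w).
    exact/(ball_act _ _ _ gH iV Hg).
  by rewrite lt_act.
Qed.

Lemma owner_total V e : edges_of V e -> ~ bridge V e -> exists2 v, V v & owner V e v.
Proof.
move=> Xe nbr; have [b fb] : exists b, finite_set (ball V e b).
  by apply: contrapT => nfb; apply: nbr; split=> // b fb; apply: nfb; exists b.
have ball0 c : ball V e c !=set0 by exists (edge_end e c); apply: ball_center.
have [m bm mmin] := set_min ltP fb (ball0 b).
have [fb' | nfb'] := pselect (finite_set (ball V e (~~ b))); last first.
  by exists m; [case: bm|exists b; split=> // /nfb'].
have [m' bm' mmin'] := set_min ltP fb' (ball0 (~~ b)).
have mm' : m != m' by apply: contraPneq bm => ->; move=> /ball_disjoint; apply.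
have [_ _ tot] := ltP; case/orP: (tot _ _ mm') => [lmm' | lm'm].
  exists m'; first by case: bm'.
  by exists (~~ b); rewrite negbK; split=> // _; exists m.
by exists m; [case: bm|exists b; split=> // _; exists m'].
Qed.

(** If one edge were smaller, both of its balls would lie in the finite ball of the other edge whose
    least vertex is [v]. But its ball opposite to [v], being finite, contains a vertex below [v]. *)
Lemma owner_inj V e e' v : edges_of V e -> edges_of V e' ->
  owner V e v -> owner V e' v -> e = e'.
Proof.
have nlt f f' : edges_of V f -> owner V f v -> owner V f' v -> ~ elt f f'.
  move=> Xf [b [_ bv _ vopp]] [b' [fb' b'v vmin' _]] ff'.
  have sub c := ball_nested (c := c) Xf ff' bv b'v.
  have [w /sub/vmin' + wv] := vopp (sub_finite_set (sub _) fb').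
  by rewrite wv.
move=> Xe Xe' ov ov'; apply: contrapT => /elt_total[]; exact: nlt.
Qed.

(** Owners obtained from opposite balls would each be above a vertex of the other ball, hence above
    each other. *)
Lemma owner_fun V e v v' : owner V e v -> owner V e v' -> v = v'.
Proof.
have [irr tr tot] := ltP.
move=> [b [fb bv vmin vopp]] [b' [fb' bv' vmin' vopp']].
have [bb' | bb'] := eqVneq b b'.
  move: bv' vmin'; rewrite -bb' => bv' vmin'; apply/eqP; apply: contraT => /tot/orP[].
    by move=> vv'; have := vmin' _ bv; rewrite vv'.
  by move=> vv'; have := vmin _ bv'; rewrite vv'.
have {bb'} E : b' = ~~ b by case: b b' bb' {fb bv vmin vopp fb' bv' vmin' vopp'} => [] [].
move: fb' bv' vmin' vopp'; rewrite E negbK => fb' bv' vmin' /(_ fb)[w bw wv'].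
have [w' bw' w'v] := vopp fb'.
have [vv' | /tot/orP[vv' | vv']] := eqVneq v v'; first exact: vv'.
  by have := vmin' _ bw'; rewrite (tr _ _ _ w'v vv').
by have := vmin _ bw; rewrite (tr _ _ _ wv' vv').
Qed.

(** The translates of [f] by powers of [g] decrease, so no edge between [x] and [g ^+ n * x] exceeds
    [f], and these points stay in the ball. They are distinct because [g] has infinite order. *)
Lemma descending_ball H V g e f b x : stable_under H V -> H g -> g <> 1 ->
    (forall f', sep f' x (g * x) -> f' = f \/ elt f' f) ->
    elt (edge_act g f) f -> elt f e -> ball V e b x ->
  infinite_set (ball V e b).
Proof.
move=> iV Hg g1 xgx gf fe bx.
have gnx n : ball V e b (g ^+ n * x) /\
    (forall f', sep f' x (g ^+ n * x) -> f' = f \/ elt f' f).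
  elim: n => [|n [bn sn]].
    by rewrite expg0 mul1g; split=> // f'; rewrite sepxx.
  have sn1 f' : sep f' x (g ^+ n.+1 * x) -> f' = f \/ elt f' f.
    case/(sep_split (g * x)) => [/xgx //|]; rewrite expgS -mulgA.
    rewrite -(sep_act freeS g^-1) !mulKg => /sn f'f; right.
    rewrite -[f'](edge_actK g^-1) invgK.
    by case: f'f => [-> //|]; rewrite -(elt_act g) => /elt_trans; apply.
  split=> //; apply: (ball_near bx) => [|f' /sn1[-> //|f'f]].
    rewrite expgS -mulgA; apply: iV => //; by case: bn.
  exact: elt_trans f'f fe.
have inj m n : (m <= n)%N -> g ^+ m * x = g ^+ n * x -> m = n.
  move=> mn /mulIg E; apply/eqP; rewrite eqn_leq mn leqNgt; apply/negP => ltmn.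
  have /eqP g1' := negbTE (introN eqP g1).
  have := torsion_free (n - m).-1 (introN eqP g1); rewrite prednK ?subn_gt0 //.
  by rewrite expgnFr // -E mulgV eqxx.
apply: (@injective_infinite _ _ (fun n => g ^+ n * x)) => [m n /= E|n].
  by have [/inj->|/ltnW/inj->] := leqP m n.
by case: (gnx n).
Qed.

Lemma sep_max x y : x <> y -> exists2 f, sep f x y &
  forall f', sep f' x y -> f' = f \/ elt f' f.
Proof.
move=> /(sep_neq freeS)[f0 sf0]; have [r sr] := sep_finite freeS x y.
have [|f] := seq_min (s := [seq f <- r | sep f x y]) (strict_total_flip eltP).
  move=> r0; have : f0 \in [seq f <- r | sep f x y] by rewrite mem_filter sf0 sr.
  by rewrite r0.
rewrite mem_filter => /andP[sf _] fmax; exists f => // f' sf'.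
by apply: fmax; rewrite mem_filter sf' sr.
Qed.

(* If g moved x within the ball, the powers of g or of g^-1 would move the
   largest edge between x and g * x downwards forever. *)
Lemma finite_ball_rigid H V g e b x : is_subgroup H -> stable_under H V -> H g ->
  finite_set (ball V e b) -> ball V e b x -> ball V e b (g * x) -> g = 1.
Proof.
move=> gH iV Hg fb bx bgx; apply: contrapT => g1.
have xgx : x <> g * x.
  by move=> E; apply: g1; apply: (@mulIg _ x); rewrite mul1g -E.
have [f sf fmax] := sep_max xgx; have fe := ball_sep bx bgx sf.
have [] := @elt_total (edge_act g f) f.
- by move=> /edge_act_free.
- by move=> gf; have := descending_ball iV Hg g1 fmax gf fe bx.
rewrite -(elt_act g^-1) edge_actK => gf.
(* Here [g] moves [f] upwards, so [g^-1] moves downwards the largest edge between [x] and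
   [g^-1 * x], which is the translate of [f] by [g^-1]. *)
have := @descending_ball H V g^-1 e (edge_act g^-1 f) b x iV (subgroupV gH Hg).
apply=> //; first by move=> E; apply: g1; apply: invg_inj; rewrite E invg1.
- move=> f'; rewrite -(sep_act freeS g) mulVKg sepC => /fmax.
  case=> [<-|]; first by rewrite edge_actK; left.
  by rewrite -(elt_act g^-1) edge_actK; right.
- by rewrite elt_act.
- exact: elt_trans gf fe.
Qed.

Lemma boundary_exists (U : set G) x y : U x -> ~ U y ->
  exists2 f, sep f x y & exists b, U (edge_end f b) /\ ~ U (edge_end f (~~ b)).
Proof.
move=> Ux nUy; apply: contrapT => nb.
suff : `[< U x >] = `[< U y >] by rewrite asboolT // asboolF.
apply: (sep_constant freeS (c := fun z => `[< U z >])) => f sf.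
apply: asbool_equiv_eq.
by split=> Uf; apply: contrapT => nUf; apply: nb; exists f => //;
   [exists false|exists true].
Qed.

(** The last hypothesis makes edges between points of [U] smaller than the edges of [V] leaving [U].
    Only finitely many edges of [V] touch [U], so a least one leaves it; its ball fills [U] and
    cannot leave [U]. *)
Lemma least_boundary H V (rX : seq (G * G)) U u0 x0 : convex V ->
    (forall e, edges_of V e -> exists2 d, d \in rX & same_orbit (@edge_act G) H d e) ->
    finite_set U -> U `<=` V -> U u0 -> V x0 -> ~ U x0 ->
    (forall f x y e b, U x -> U y -> sep f x y -> edges_of V e ->
       U (edge_end e b) -> ~ U (edge_end e (~~ b)) -> elt f e) ->
  exists e b, edges_of V e /\ ball V e b = U.
Proof.
move=> cV XrX /finite_seqP[s Us] UV Uu0 Vx0 nUx0 inner.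
pose bd e b := [/\ edges_of V e, U (edge_end e b) & ~ U (edge_end e (~~ b))].
(* Each representative in [rX] is translated so as to bring one of its ends to a point of [U]. *)
pose star := [seq edge_act (p.1.1 * (edge_end p.2 p.1.2)^-1) p.2
  | p <- allpairs pair (allpairs pair s [:: true; false]) rX].
have bd_star e b : bd e b -> e \in star.
  case=> Xe Ue _; have [d dX [g Hg E]] := XrX e Xe.
  apply/mapP; exists ((edge_end e b, b), d); last by rewrite /= {2}E edge_end_act mulgK -E.
  apply: allpairs_f => //; apply: allpairs_f; last by case: (b).
  by move: Ue; rewrite Us.
have Vbd x y : U x -> V y -> ~ U y -> exists2 e, sep e x y & exists b, bd e b.
  move=> Ux Vy nUy; have [e sxy [b [Ub nUb]]] := boundary_exists Ux nUy.
  by exists e => //; exists b; split=> //; apply: convex_sep sxy => //; apply: UV.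
have [|m] := seq_min (s := [seq e <- star | `[< exists b, bd e b >]]) eltP.
  have [e _ [b be]] := Vbd u0 x0 Uu0 Vx0 nUx0.
  move=> star0; have : e \in [seq e <- star | `[< exists b, bd e b >]].
    by rewrite mem_filter (bd_star e b be) andbT; apply/asboolP; exists b.
  by rewrite star0.
rewrite mem_filter => /andP[/asboolP[b [Xm Um nUm]] _] mmin.
exists m, b; split=> //; apply/seteqP; split=> [w [Vw wm]|w Uw]; last first.
  split; first exact: UV.
  by move=> f sf; exact: (inner _ _ _ _ _ Um Uw sf Xm Um nUm).
apply: contrapT => nUw; have [e sxy [c be]] := Vbd _ w Um Vw nUw.
have := wm e sxy; have [|->|me] := mmin e; last by move/(elt_trans me); rewrite elt_irr.
  by rewrite mem_filter (bd_star e c be) andbT; apply/asboolP; exists c.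
by rewrite elt_irr.
Qed.

(** Among the finite balls with least vertex [v], whose sizes are bounded by rigidity, a largest one
    is taken. If [v] did not own its edge, the union with the opposite ball would be finite with
    least vertex [v], and it would be a larger ball of another edge. *)
Lemma owner_onto H V (rX : seq (G * G)) (rV : seq G) v : is_subgroup H ->
    stable_under H V -> convex V ->
    (forall e, edges_of V e -> exists2 d, d \in rX & same_orbit (@edge_act G) H d e) ->
    (forall w, V w -> exists2 d, d \in rV & same_orbit ( *%g ) H d w) ->
    infinite_set V -> V v ->
  exists2 e, edges_of V e & owner V e v.
Proof.
move=> gH iV cV XrX VrV infV Vv; have [irr tr tot] := ltP.
pose good e b s := [/\ edges_of V e, uniq s, ball V e b = [set` s], v \in s
  & forall w, w \in s -> ~~ lt w v].
have good_size e b s : good e b s -> (size s <= size rV)%N.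
  case=> Xe us bs _ _.
  have bE w : (w \in s) = true -> ball V e b w by rewrite bs.
  have fb : finite_set (ball V e b) by rewrite bs; apply: finite_seq.
  apply: (@rel_leq_size _ _ (fun w d => same_orbit ( *%g ) H d w)) => //.
    by move=> w ws; apply: VrV; case: (bE w ws).
  have actM : forall g g' w : G, g * g' * w = g * (g' * w) by move=> *; rewrite mulgA.
  move=> x y d xs ys _ dx dy.
  have [g Hg E] : same_orbit ( *%g ) H x y.
    apply: same_orbit_trans dy => //.
    by apply: same_orbit_sym dx => //; exact: mul1g.
  rewrite E; suff -> : g = 1 by rewrite mul1g.
  by apply: (finite_ball_rigid gH iV Hg fb (bE x xs)); rewrite -E; apply: bE.
have grow U : finite_set U -> U `<=` V -> U v -> (forall w, U w -> ~~ lt w v) ->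
    (forall f x y e b, U x -> U y -> sep f x y -> edges_of V e ->
       U (edge_end e b) -> ~ U (edge_end e (~~ b)) -> elt f e) ->
    exists e b s, good e b s /\ U = [set` s].
  move=> fU UV Uv Umin inner.
  have [x Vx nUx] : exists2 x, V x & ~ U x.
    apply: contrapT => nx; apply: infV; apply: sub_finite_set fU => x Vx.
    by apply: contrapT => nUx; apply: nx; exists x.
  have [e [b [Xe bU]]] := least_boundary cV XrX fU UV Uv Vx nUx inner.
  have /finite_seqP[s0 Us] := fU; exists e, b, (undup s0); split.
    split=> //; first exact: undup_uniq.
    - by rewrite bU Us; apply/seteqP; split=> w /=; rewrite mem_undup.
    - by rewrite mem_undup; move: Uv; rewrite Us.
    - by move=> w; rewrite mem_undup => ws; apply: Umin; rewrite Us.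
  by rewrite Us; apply/seteqP; split=> w /=; rewrite mem_undup.
pose P n := `[< exists e b s, good e b s /\ size s = n >].
have exP : exists n, P n.
  have [|_ ->||w ->|f x y e b -> ->|e [b [s [gs _]]]] := grow [set v].
  - exact: finite_set1.
  - exact: Vv.
  - by [].
  - by rewrite irr.
  - by rewrite sepxx.
  - by exists (size s); apply/asboolP; exists e, b, s.
have maxP n : P n -> (n <= size rV)%N.
  by move=> /asboolP[e [b [s [gs <-]]]]; apply: good_size gs.
case: (ex_maxnP exP maxP) => n /asboolP[e [b [s [gs <-]]]] nmax {exP maxP n}.
have [Xe us bs vs smin] := gs; have bE w : (w \in s) = true -> ball V e b w by rewrite bs.
exists e => //; exists b; split; rewrite ?bs //.
move=> fb'; apply: contrapT => nw.
pose U := ball V e b `|` ball V e (~~ b).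
have UE c w : ball V e c w -> U w.
  have [->|cb] := eqVneq c b; first by left.
  have -> : c = ~~ b by case: (c) (b) cb => [] [].
  by right.
have US w : U w -> exists c, ball V e c w by case; [exists b|exists (~~ b)].
have U_sep x y f : U x -> U y -> sep f x y -> f = e \/ elt f e.
  move=> /US[c cx] /US[c' c'y] sf; have [E|cc'] := eqVneq c c'.
    by right; apply: (ball_sep cx _ sf); rewrite E.
  have E : c' = ~~ c by case: (c) (c') cc' => [] [].
  by apply: (ball_sep_opp Xe cx _ sf); rewrite -E.
have [|w /US[c []] //|||f x y e' c Ux Uy sf Xe' Ue' nUe'|] := grow U.
- by rewrite finite_setU bs; split=> //; apply: finite_seq.
- by apply: (UE b); apply: bE.
- move=> w [|bw]; first by rewrite bs => /smin.
  by apply/negP => wv; apply: nw; exists w.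
- have [ce' cUe'] := US _ Ue'.
  (* Crossing an edge of [V] smaller than [e] does not leave a ball of [e], and [e] joins its two
     balls; so an edge leaving [U] is larger than [e]. *)
  have ee' : elt e e'.
    have [E | /elt_total[] //] := pselect (e = e').
      by case: nUe'; rewrite -E; apply: (UE (~~ c)); apply: ball_center.
    move=> e'e; case: nUe'; apply: (UE ce'); apply: ball_near cUe' _ _.
      by case: Xe'.
    by move=> f'; rewrite sep_edge_end; [move/eqP->|case: Xe'].
  by case: (U_sep x y f Ux Uy sf) => [-> //|fe]; apply: elt_trans fe ee'.
move=> e' [b' [s' [gs' Us']]].
have /(nmax (size s')) : P (size s') by apply/asboolP; exists e', b', s'.
apply/negP; rewrite -ltnNge.
have -> : (size s < size s')%N = (size (edge_end e (~~ b) :: s) <= size s')%N by [].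
have Us'E w : U w -> w \in s' by rewrite Us'.
apply: uniq_leq_size => [/=|w].
  rewrite us andbT; apply/negP => /bE be.
  by apply: (ball_disjoint Xe be); apply: ball_center.
rewrite inE => /orP[/eqP->|/bE bw]; apply: Us'E; last exact: UE bw.
by apply: (UE (~~ b)); apply: ball_center.
Qed.

End Balls.

(** * Orbits of edges and vertices *)

Section Counting.
Variables (G : groupType) (S : set G) (lt : rel G).
Hypotheses (freeS : free_basis S [set: G]) (ltP : strict_total lt).
Hypothesis lt_act : forall g x y, lt (g * x) (g * y) = lt x y.
Implicit Types (x y z g u v w : G) (e f : G * G) (b c : bool) (H L V U : set G).

Local Notation edges_orbit := (same_orbit (@edge_act G)).

Variables (H V : set G) (DX : seq (G * G)) (DV : seq G).
Hypotheses (gH : is_subgroup H) (iV : stable_under H V) (cV : convex S V).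
Hypothesis XDX : transversal_of (@edge_act G) H (edges_of S V) DX.
Hypothesis VDV : transversal_of ( *%g : G -> G -> G) H V DV.

Local Notation nonbridges := [seq e <- DX | ~~ `[< bridge S lt V e >]].

(** Passing to an owner commutes with [H] and is injective. The bound covers finite [V], the case of
    a trivial intersection. *)
Lemma nonbridges_leq : (size nonbridges <= size DV)%N.
Proof.
have [uX DX_X XX rX] := XDX; have [uV DV_V VV rV] := VDV.
apply: (@rel_leq_size _ _ (fun e d => exists2 g, H g & owner S lt V e (g * d))).
- exact: filter_uniq.
- move=> e; rewrite mem_filter => /andP[/asboolPn nbr /DX_X Xe].
  have [v Vv ov] := owner_total freeS ltP Xe nbr.
  have [d dV [g Hg def_v]] := VV v Vv.
  by exists d => //; exists g; rewrite // -def_v.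
move=> e e' d; rewrite !mem_filter => /andP[_ eX] /andP[_ e'X] dV [g Hg ov] [g' Hg' ov'].
have Hgg : H (g' * g^-1) by apply: (subgroupM gH) => //; apply: (subgroupV gH).
apply: rX => //; exists (g' * g^-1) => //; apply/esym.
have := owner_act freeS lt_act gH iV Hgg ov; rewrite mulgA mulgVK => ov2.
apply: (owner_inj freeS ltP _ _ ov2 ov'); last exact: DX_X.
exact: edges_of_act iV Hgg (DX_X _ eX).
Qed.

(** By [owner_onto] every vertex owns an edge, and an edge has only one owner, so distinct vertex
    orbits use distinct edge orbits. *)
Lemma nonbridges_geq : infinite_set V -> (size DV <= size nonbridges)%N.
Proof.
have [uX DX_X XX rX] := XDX; have [uV DV_V VV rV] := VDV => infV.
apply: (@rel_leq_size _ _ (fun d e => exists2 g, H g &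
  owner S lt V (edge_act g e) d)) => //.
- move=> d /DV_V Vd.
  have [e Xe ov] := owner_onto freeS ltP lt_act gH iV cV XX VV infV Vd.
  have [e0 e0X [g Hg def_e]] := XX e Xe.
  exists e0; last by exists g; rewrite // -def_e.
  rewrite mem_filter e0X andbT; apply/asboolPn => -[_ inf].
  have [b [fb _ _ _]] := ov; apply: (inf b).
  by apply/(finite_ball_act freeS lt_act e0 b gH iV Hg); rewrite -def_e.
move=> d d' e dV d'V _ [g Hg ov] [g' Hg' ov'].
have Hgg : H (g' * g^-1) by apply: (subgroupM gH) => //; apply: (subgroupV gH).
apply: rV => //; exists (g' * g^-1) => //; apply/esym.
have := owner_act freeS lt_act gH iV Hgg ov; rewrite -edge_actM mulgVK => ov2.
exact: (owner_fun ltP ov2 ov').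
Qed.

(* Functions on the edge orbits are determined by their potentials at the
   generators of H and at all but one of the vertex representatives. *)
Lemma edge_orbits_leq (a : seq G) : V 1 -> generated [set` a] = H ->
  (size DX < size DV + size a)%N.
Proof.
have [uX DX_X XX rX] := XDX; have [uV DV_V VV rV] := VDV => V1 Ha.
have [d0 d0V [g0 Hg0 def1]] := VV 1 V1.
pose DV' := rem d0 DV.
(* The function on edges with values [t] on the orbits of [DX]. Any other edge gets the default
   [false], since [find] then returns [size DX]. *)
pose F (t : seq bool) e := nth false t (find (fun d => `[< edges_orbit H d e >]) DX).
pose m := (size DV' + size a)%N.
pose code (t : (size DX).-tuple bool) : m.-tuple bool :=
  insubd [tuple of nseq m false]
    ([seq potential S (F t) v | v <- DV'] ++ [seq potential S (F t) z | z <- a]).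
have F_act t g e : H g -> F t (edge_act g e) = F t e.
  move=> Hg; rewrite /F; congr nth; apply: eq_find => d; apply: asbool_equiv_eq.
  split=> [|[g' Hg' ->]]; last first.
    by exists (g * g'); [exact: subgroupM|rewrite edge_actM].
  case=> g' Hg' E; exists (g^-1 * g'); last by rewrite edge_actM -E edge_actK.
  by apply: (subgroupM gH) => //; apply: (subgroupV gH).
have F_nth t i : (i < size DX)%N -> F t (nth (1, 1) DX i) = nth false t i.
  move=> iX; rewrite /F; congr nth; have diX := mem_nth (1, 1) iX.
  set p := fun d => _; have hp : has p DX.
    apply/hasP; exists (nth (1, 1) DX i) => //; apply/asboolP.
    by apply: same_orbit_refl => //; apply: edge_act1.
  have /asboolP/rX E := nth_find (1, 1) hp.
  apply/eqP; rewrite -(nth_uniq (1, 1) _ iX uX) -?has_find //; apply/eqP.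
  by apply: E => //; apply: mem_nth; rewrite -has_find.
have code_inj : injective code.
  move=> t t' /(congr1 val); rewrite !val_insubd !size_cat !size_map eqxx.
  move=> /eqP; rewrite eqseq_cat ?size_map //.
  case/andP=> [/eqP/eq_in_map Vtt' /eqP/eq_in_map att'].
  (* This difference of potentials is additive on [H], so it vanishes on [H] once it does on the
     generators, and then on [V]. Hence [F t] and [F t'] agree on the edges of [V]. *)
  pose c x := potential S (F t) x (+) potential S (F t') x.
  have c1 : c 1 = false by rewrite /c !potential1.
  have cS x s : S s -> c (x * s) = c x (+) (F t (x, s) (+) F t' (x, s)).
    move=> Ss; rewrite /c !potential_edge //.
    by rewrite -!addbA; congr (_ (+) _); rewrite addbCA.
  have cM z x : H z -> c (z * x) = c z (+) c x.
    move=> Hz; suff : c (z * x) (+) c x = c (z * 1) (+) c 1.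
      by rewrite mulg1 c1 addbF => <-; rewrite -addbA addbb addbF.
    apply: (sep_constant freeS (c := fun x => c (z * x) (+) c x)) => e.
    move=> /(sep_basis freeS) Se /=; rewrite mulgA (cS (z * e.1)) // (cS e.1) //.
    have := F_act t z e Hz; have := F_act t' z e Hz.
    rewrite /edge_act => -> ->; case: e Se => x0 s /= _.
    by move: (c (z * x0)) (c x0) (F t _) (F t' _) => [] [] [] [].
  have cH z : H z -> c z = false.
    suff : generated [set` a] `<=` [set z | H z /\ c z = false] by rewrite Ha => sub /sub[].
    apply: generated_min => [|y ay]; last first.
      split; first by rewrite -Ha; apply: generated_sub.
      by rewrite /c att' ?addbb.
    apply/subgroupP; split=> [|x y [Hx cx] [Hy cy]|x [Hx cx]].
    - by split; [exact: subgroup1 gH|].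
    - by split; [exact: subgroupM|rewrite cM // cx cy].
    - have HVx := subgroupV gH Hx; split=> //.
      by have /esym := cM x x^-1 Hx; rewrite mulgV c1 cx.
  have cDV d : d \in DV -> c d = false.
    have [-> _|dd0 dV] := eqVneq d d0.
      by have /esym := cM g0 d0 Hg0; rewrite -def1 c1 cH.
    by rewrite /c Vtt' ?addbb // mem_rem_uniq // inE dd0.
  have cV0 v : V v -> c v = false.
    by move=> /VV[d dV [g Hg ->]]; rewrite cM // cH // cDV.
  apply: val_inj; apply: (@eq_from_nth _ false); first by rewrite !size_tuple.
  move=> i; rewrite size_tuple => iX; rewrite -!F_nth //.
  have [Sd Vd] := DX_X _ (mem_nth (1, 1) iX).
  have := cS (nth (1, 1) DX i).1 _ Sd.
  rewrite (cV0 _ (Vd false)) (cV0 _ (Vd true)) -surjective_pairing.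
  by case: (F t _); case: (F t' _).
(* Comparing powers of 2 gives [size DX <= m]; the removal of [d0] from [DV] makes the final bound
   strict. *)
have := leq_card code code_inj; rewrite !card_tuple card_bool leq_exp2l //.
rewrite /m /DV' size_rem //; have : (0 < size DV)%N by case: (DV) d0V.
by move: (size DX) (size DV) (size a) => n p q; lia.
Qed.

End Counting.

(** * Schreier bases *)

Lemma transversal_leq (G : groupType) (T : choiceType) (act : G -> T -> T) H A D r :
    (forall t, act 1 t = t) ->
    (forall g g' t, act (g * g') t = act g (act g' t)) -> is_subgroup H ->
    transversal_of act H A D ->
    (forall t, A t -> exists2 d, d \in r & same_orbit act H d t) ->
  (size D <= size r)%N.
Proof.
move=> act1 actM gH [uD DA _ rD] Ar.
apply: (@rel_leq_size _ _ (fun t d => same_orbit act H d t)) => //.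
  by move=> t /DA/Ar.
move=> t t' d tD t'D _ dt dt'; apply: rD => //.
by apply: same_orbit_trans dt' => //; apply: same_orbit_sym.
Qed.

Lemma card_seq (T : eqType) (s : seq T) : uniq s -> ([set` s] #= `I_(size s))%card.
Proof.
move=> us; apply/pcard_eqP/bijPex; exists (index^~ s); split.
- by move=> x /=; rewrite index_mem.
- by move=> x y /set_mem xs /set_mem ys; apply: index_inj.
- case: s us => [//|x0 s] us i /= ilt; exists (nth x0 (x0 :: s) i); first exact: mem_nth.
  by rewrite -[LHS]/(index _ (x0 :: s)) index_uniq.
Qed.

Lemma card_eq_seq (T : eqType) (A : set T) n : (A #= `I_n)%card ->
  exists2 s : seq T, size s = n & A = [set` s].
Proof.
move=> An; have /finite_seqP[s As] : finite_set A by exists n.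
have {}As : A = [set` undup s].
  by rewrite As; apply/seteqP; split=> x /=; rewrite mem_undup.
exists (undup s) => //; apply/eqP; rewrite eqn_leq -!card_le_II.
have := card_seq (undup_uniq s); rewrite -As => As'.
have := card_eq_trans (card_esym As') An; rewrite card_eqPle => -[le1 le2]; exact/andP.
Qed.

Section SchreierBasis.
Variables (G : groupType) (S : set G).
Hypothesis freeS : free_basis S [set: G].
Implicit Types (x y z g u v w d : G) (e f : G * G) (b c : bool) (U : set G).

Local Notation sep := (sep S).
Local Notation edges_orbit := (same_orbit (@edge_act G)).
Local Notation vertex_orbit := (same_orbit ( *%g : G -> G -> G)).

Let vertex_actM g g' w : g * g' * w = g * (g' * w).
Proof. by rewrite mulgA. Qed.

Variables (L V : set G) (DX : seq (G * G)) (DV : seq G).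
Hypotheses (gL : is_subgroup L) (iV : stable_under L V) (cV : convex S V) (V1 : V 1).
Hypothesis XDX : transversal_of (@edge_act G) L (edges_of S V) DX.
Hypothesis VDV : transversal_of ( *%g : G -> G -> G) L V DV.

(** A finite lift, rooted at 1, of a subtree of the quotient by [L]. The Euler relation between [D]
    and [I] is carried along as an invariant; the last clause is connectedness. *)
Definition subtree (D : seq G) (I : seq (G * G)) :=
  [/\ uniq D /\ 1 \in D, forall d, d \in D -> V d,
      forall d d', d \in D -> d' \in D -> vertex_orbit L d d' -> d = d',
      [/\ uniq I, size D = (size I).+1
        & forall e, e \in I -> edges_of S V e /\ forall b, edge_end e b \in D]
    & forall d e, d \in D -> sep e 1 d -> e \in I].

Let covers (D : seq G) :=
  forall v, V v -> exists2 d, d \in D & vertex_orbit L d v.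

(** The path from 1 to an uncovered vertex leaves the union of the translates of [D] across some
    edge. Translating its inner end into [D] gives the edge and the vertex to add. *)
Lemma subtree_grow D I : subtree D I -> ~ covers D ->
  exists D' I', subtree D' I' /\ size D' = (size D).+1.
Proof.
move=> [[uD D1] DV' rD [uI szI IX] DI] ncov.
have [v Vv nv] : exists2 v, V v & ~ exists2 d, d \in D & vertex_orbit L d v.
  by apply: contrapT => nv; apply: ncov => v Vv; apply: contrapT => nd; apply: nv; exists v.
pose U := [set v | exists2 d, d \in D & vertex_orbit L d v].
have U1 : U 1 by exists 1 => //; apply: same_orbit_refl => //; exact: mul1g.
have [f sf [b [[d dD [g Lg fb]] nU]]] := boundary_exists freeS (U := U) U1 nv.
have Xf := convex_sep freeS cV V1 Vv sf.
have LVg := subgroupV gL Lg.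
pose e := edge_act g^-1 f; pose v' := edge_end e (~~ b).
have Xe : edges_of S V e by apply: edges_of_act iV LVg Xf.
have eb : edge_end e b = d by rewrite edge_end_act fb mulKg.
have nv' d' : d' \in D -> ~ vertex_orbit L d' v'.
  move=> d'D [g' Lg' E]; apply: nU; exists d' => //; exists (g * g').
    exact: subgroupM.
  by rewrite -mulgA -E /v' /e edge_end_act mulVKg.
have v'D : v' \notin D.
  by apply/negP => v'D; apply: (nv' v') => //; apply: same_orbit_refl => //; exact: mul1g.
exists (v' :: D), (e :: I); split=> //; split.
- by rewrite /= v'D uD inE D1 orbT.
- by move=> d'; rewrite inE => /orP[/eqP->|/DV' //]; case: Xe => _; apply.
- move=> d1 d2; rewrite !inE => /orP[/eqP->|d1D] /orP[/eqP->|d2D] //; last exact: rD.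
    by move=> /(same_orbit_sym (@mul1g G) vertex_actM gL)/nv'.
  by move/nv'.
- split=> [/=||e'].
  + rewrite uI andbT; apply/negP => /IX[_ /(_ (~~ b))]; exact/negP.
  + by rewrite /= szI.
  + rewrite inE => /orP[/eqP->|/IX[Xe' e'D]]; split=> // c; last by rewrite inE e'D orbT.
    have [->|cb] := eqVneq c b; first by rewrite eb inE dD orbT.
    have -> : c = ~~ b by case: (c) (b) cb => [] [].
    exact: mem_head.
move=> d' e'; rewrite !inE => /orP[/eqP->|/DI h]; last by move/h->; rewrite orbT.
case/(sep_split d) => [/DI->|]; rewrite ?orbT //.
by rewrite -eb sep_edge_end // ?orbT => [->|] //; case: Xe.
Qed.

Lemma spanning_subtree : exists D I, subtree D I /\ covers D.
Proof.
have VV : covers DV by case: VDV.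
have bound D I : subtree D I -> (size D <= size DV)%N.
  move=> [[uD _] DV' rD _ _].
  apply: (@rel_leq_size _ _ (fun t d => vertex_orbit L d t)) => //.
    by move=> t /DV'/VV.
  move=> t t' d tD t'D _ dt dt'; apply: rD => //.
  by apply: same_orbit_trans dt' => //; apply: same_orbit_sym => //; exact: mul1g.
apply: contrapT => nspan.
have big n : exists D I, subtree D I /\ size D = n.+1.
  elim: n => [|n [D [I [DI szD]]]].
    exists [:: 1], [::]; split=> //; split=> [|d|d d'||d e].
    - by rewrite /= inE eqxx.
    - by rewrite inE => /eqP->.
    - by rewrite !inE => /eqP-> /eqP->.
    - by split.
    - by rewrite inE => /eqP->; rewrite sepxx.
  have [|D' [I' [DI' szD']]] := subtree_grow DI.
    by move=> cov; apply: nspan; exists D, I.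
  by exists D', I'; rewrite szD' szD.
have [D [I [/bound + szD]]] := big (size DV).
by rewrite szD ltnn.
Qed.

(** Each edge of [EX] starts in the spanning lift [D] and ends outside it, in the translate of [D]
    by the Schreier generator [gen e]. There are at most [size DX - size I] of them, and [size I] is
    one less than [size D], which is at least [size DV]. *)
Lemma schreier_basis : exists r, has_rank L r /\ (r + size DV <= (size DX).+1)%N.
Proof.
have [uX DX_X XX rX] := XDX.
have [D [I [[[uD D1] DV' rD [uI szI IX] DI] cov]]] := spanning_subtree.
have szD : (size DV <= size D)%N.
  exact: (transversal_leq (@mul1g G) vertex_actM gL VDV cov).
have rD1 g d : L g -> d \in D -> g * d \in D -> g = 1.
  move=> Lg dD gdD; have : d = g * d by apply: rD => //; exists g.
  by move=> E; apply: (@mulIg _ d); rewrite -E mul1g.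
have /choice[shift shiftP] e : exists e', e \in DX -> edges_orbit L e e' /\ e'.1 \in D.
  have [eX | neX] := boolP (e \in DX); last by exists e.
  have [_ Ve] := DX_X e eX; have [d dD [g Lg E]] := cov _ (Ve false).
  exists (edge_act g^-1 e) => _; split; first by exists g^-1; first exact: subgroupV gL Lg.
  by rewrite /= -[e.1]/(edge_end e false) E mulKg.
pose ED := map shift DX.
have EDP e : edges_of S V e -> e.1 \in D -> e \in ED.
  move=> Xe eD; have [e0 e0X [g Lg E]] := XX e Xe; apply/mapP; exists e0 => //.
  have [[g' Lg' E'] e'D] := shiftP e0 e0X.
  have Lgg : L (g' * g^-1) by apply: (subgroupM gL) => //; apply: (subgroupV gL).
  have E2 : shift e0 = edge_act (g' * g^-1) e by rewrite E -edge_actM mulgVK.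
  have : g' * g^-1 = 1 by apply: (rD1 _ _ Lgg eD); move: e'D; rewrite E2.
  by rewrite E2 => ->; rewrite edge_act1.
have ED_X e : e \in ED -> edges_of S V e /\ e.1 \in D.
  case/mapP=> e0 e0X ->; have [[g Lg E] e0D] := shiftP e0 e0X.
  by split=> //; rewrite E; apply: edges_of_act iV Lg (DX_X _ e0X).
pose EX := [seq e <- ED | e.1 * e.2 \notin D].
have EXP e : e \in EX -> [/\ edges_of S V e, e.1 \in D & e.1 * e.2 \notin D].
  by rewrite mem_filter => /andP[nD /ED_X[Xe eD]].
have szEX : (size EX + size I <= size DX)%N.
  rewrite -(size_map shift DX) -/ED -(count_predC (fun e => e.1 * e.2 \notin D) ED).
  rewrite [size EX]size_filter leq_add2l -size_filter; apply: uniq_leq_size => // e eI.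
  have [Xe eD] := IX e eI; rewrite mem_filter /= negbK (eD true).
  exact: EDP Xe (eD false).
have /choice[gen genP] e : exists g, e \in EX -> L g /\ g^-1 * (e.1 * e.2) \in D.
  have [eX | neX] := boolP (e \in EX); last by exists 1.
  have [[_ Ve] _ _] := EXP e eX; have [d dD [g Lg E]] := cov _ (Ve true).
  by exists g => _; split=> //; rewrite -[_ * e.2]/(edge_end e true) E mulKg.
pose Y := undup (map gen EX).
have YL : [set` Y] `<=` L.
  by move=> y /=; rewrite mem_undup => /mapP[e eX ->]; case: (genP e eX).
have inner g e d : L g -> e \in EX -> d \in D -> sep (edge_act g e) 1 d = false.
  move=> Lg eX dD; apply/negP => /(DI _ _ dD)/IX[_ ends]; have [_ eD neD] := EXP e eX.
  have g1 : g = 1 by apply: (rD1 _ _ Lg eD); apply: (ends false).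
  by move: (ends true); rewrite edge_end_act g1 mul1g; apply/negP.
(* The geodesic from 1 to [gen e] runs inside [D] to [e.1], crosses [e] and goes on inside the
   translate of [D] by [gen e]; of all translates of edges of [EX] it meets only [e]. *)
have cross g e e' : L g -> e \in EX -> e' \in EX ->
    sep (edge_act g e') 1 (gen e) = (g == 1) && (e' == e).
  move=> Lg eX e'X; have [Lgen genD] := genP e eX; have LVgen := subgroupV gL Lgen.
  have [[Se _] eD neD] := EXP e eX; have [_ e'D _] := EXP e' e'X.
  rewrite (sepD S _ e.1) inner // (sepD S _ (e.1 * e.2)) sep_edge //.
  have -> : sep (edge_act g e') (e.1 * e.2) (gen e) = false.
    rewrite sepC -(sep_act freeS (gen e)^-1) -edge_actM mulVg inner //.
    exact: subgroupM.
  rewrite addbF addFb -surjective_pairing; apply/eqP/andP => [E | [/eqP-> /eqP->]].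
    have g1 : g = 1 by apply: (rD1 _ e'.1) => //; move: eD; rewrite -E.
    by move: E; rewrite g1 edge_act1 => ->.
  by rewrite edge_act1.
have /choice[edge edgeP] y : exists e, y \in Y -> e \in EX /\ gen e = y.
  have [yY | nyY] := boolP (y \in Y); last by exists (1, 1).
  by move: yY; rewrite mem_undup => /mapP[e eX ->]; exists e.
exists (size Y); split; last first.
  have : (size Y <= size EX)%N by rewrite (leq_trans (size_undup _)) ?size_map.
  by move: szEX szD; rewrite szI; lia.
exists [set` Y]; last exact/card_seq/undup_uniq.
split; last first.
  apply: (@free_of_crossing _ L _ (fun z p => sep (edge_act p.1 (edge p.2)) 1 z)) => //.
  move=> z x y y' Lz Lx /edgeP[eX gen_e] /edgeP[e'X gen_e'].
  rewrite (sepD S _ z); congr (_ (+) _).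
  rewrite -(sep_act freeS z^-1) /= mulVg mulKg -edge_actM -{1}gen_e cross //; last first.
    by apply: subgroupM => //; apply: (subgroupV gL).
  rewrite xpair_eqE; congr (_ && _).
    by rewrite mulg_eq1 eqg_inv eq_sym.
  by apply/eqP/eqP => [E|-> //]; rewrite -gen_e -gen_e' E.
have gY := is_subgroup_generated [set` Y].
apply/seteqP; split; first exact: generated_min.
(* No edge of [V] leaves this union of translates of [D], so it contains [V]. An element of [L] in
   [W] then lies in the generated subgroup, because 1 is the only point of its [L]-orbit in [D]. *)
pose W := [set v | exists2 d, d \in D & same_orbit ( *%g ) (generated [set` Y]) d v].
have genY e : e \in EX -> generated [set` Y] (gen e).
  by move=> eX; apply: generated_sub; rewrite /= mem_undup; apply: map_f.
have WV v : V v -> W v.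
  move=> Vv; suff : `[< W 1 >] = `[< W v >].
    move=> E; apply/asboolP; rewrite -E; apply/asboolP.
    by exists 1 => //; apply: same_orbit_refl => //; exact: mul1g.
  apply: (sep_constant freeS (c := fun z => `[< W z >])) => e.
  move=> /(convex_sep freeS cV V1 Vv) Xe.
  apply: asbool_equiv_eq; split=> -[d dD [g Yg E]].
    have Lg : L g by apply: generated_min Yg.
    have Xe' := edges_of_act iV (subgroupV gL Lg) Xe.
    have e'D : (edge_act g^-1 e).1 \in D by rewrite /= E mulKg.
    have e'ED := EDP _ Xe' e'D.
    have [e'D2 | e'nD] := boolP ((edge_act g^-1 e).1 * e.2 \in D).
      by exists ((edge_act g^-1 e).1 * e.2) => //; exists g; rewrite //= -mulgA mulVKg.
    have e'X : edge_act g^-1 e \in EX by rewrite mem_filter e'nD.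
    have [Lgen genD] := genP _ e'X.
    exists ((gen (edge_act g^-1 e))^-1 * ((edge_act g^-1 e).1 * e.2)) => //.
    exists (g * gen (edge_act g^-1 e)); first exact: subgroupM gY Yg (genY _ e'X).
    by rewrite -mulgA mulVKg /= -mulgA mulVKg.
  have Lg : L g by apply: generated_min Yg.
  (* The origin of [e] lies in the translate of [D] by some [h] in [L]. Since [h^-1 * g] turns out
     to be 1 or a generator, [h] is in the generated subgroup. *)
  have [d' d'D [h Lh E']] := cov _ (proj2 Xe false).
  have Xe' := edges_of_act iV (subgroupV gL Lh) Xe.
  have e'D : (edge_act h^-1 e).1 \in D by rewrite /= -[e.1]/(edge_end e false) E' mulKg.
  have e'ED := EDP _ Xe' e'D.
  have e'2 : (edge_act h^-1 e).1 * e.2 = h^-1 * g * d by rewrite /= -mulgA E mulgA.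
  exists d' => //; exists h => //.
  have [e'D2 | e'nD] := boolP ((edge_act h^-1 e).1 * e.2 \in D).
    have : h^-1 * g = 1.
      apply: (rD1 _ d) => //; last by rewrite -e'2.
      by apply: (subgroupM gL) => //; apply: (subgroupV gL).
    by move/mulg1_eq; rewrite invgK => ->.
  have e'X : edge_act h^-1 e \in EX by rewrite mem_filter e'nD.
  have [Lgen genD] := genP _ e'X; have Ygen := genY _ e'X.
  rewrite /= in genD; move: genD; rewrite -[h^-1 * _ * _]/((edge_act h^-1 e).1 * e.2) e'2.
  rewrite mulgA => /(rD1 _ _ _ dD) gen1.
  have : (gen (edge_act h^-1 e))^-1 * (h^-1 * g) = 1.
    apply: gen1; apply: (subgroupM gL); first exact: subgroupV gL Lgen.
    by apply: (subgroupM gL) => //; apply: (subgroupV gL).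
  move/mulg1_eq; rewrite invgK => gE.
  have -> : h = g * (gen (edge_act h^-1 e))^-1 by rewrite gE invgM invgK mulVKg.
  exact: subgroupM gY Yg (subgroupV gY Ygen).
move=> z Lz; have [|d dD [g Yg E]] := WV z.
  by rewrite -[z]mulg1; apply: iV.
have Lg : L g by apply: generated_min Yg.
suff g1z : g^-1 * z = 1 by rewrite -[z](mulVKg g) g1z mulg1.
apply: (rD1 _ 1) => //; last by rewrite mulg1 E mulKg.
by apply: (subgroupM gL) => //; apply: (subgroupV gL).
Qed.

End SchreierBasis.

(** * The intersection bound *)

Section Hull.
Variables (G : groupType) (S : set G).
Hypothesis freeS : free_basis S [set: G].
Implicit Types (x y z g v : G) (e : G * G) (H : set G).

Lemma walk_ends x w e b : e \in walk x w ->
  exists u u' : seq (G * bool), w = u ++ u' /\ edge_end e b = x * word_val u.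
Proof.
case/walkP=> u [l [v [-> ->]]].
have [->|->] : edge_end (edge_at (x * word_val u) l) b = x * word_val u \/
    edge_end (edge_at (x * word_val u) l) b = x * word_val (u ++ [:: l]).
  rewrite word_val_cat word_val_cons word_val_nil mulg1 mulgA /edge_at /letter_val.
  by case: l.2; case: b; rewrite /= ?mulgVK; [left|right|right|left].
- by exists u, (l :: v).
- by exists (u ++ [:: l]), v; rewrite -catA.
Qed.

(** The lists only have to meet every orbit; [transversal_exists] later extracts exact
    representatives. *)
Definition cofinite_subtree H (V : set G) (rX : seq (G * G)) (rV : seq G) :=
  [/\ V 1, stable_under H V, convex S V,
    forall e, edges_of S V e -> exists2 d, d \in rX & same_orbit (@edge_act G) H d e
  & forall v, V v -> exists2 d, d \in rV & same_orbit ( *%g ) H d v].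

(* The subtree spanned by the orbit of 1, enlarged so as to be a union of
   translates of finitely many paths. *)
Lemma hull_exists H (a : seq G) : generated [set` a] = H ->
  exists V rX rV, cofinite_subtree H V rX rV.
Proof.
move=> Ha; have gH : is_subgroup H by rewrite -Ha; apply: is_subgroup_generated.
pose rX := flatten [seq walk 1 (word_of S z) | z <- a].
(* The vertex 1 is listed separately because the paths to the generators may have no edges. *)
pose rV := 1 :: [seq edge_end e b | e <- rX, b <- [:: true; false]].
pose X := [set e | exists2 d, d \in rX & same_orbit (@edge_act G) H d e].
pose V := [set v | exists2 d, d \in rV & same_orbit ( *%g ) H d v].
have X_act g e : H g -> X e -> X (edge_act g e).
  move=> Hg [d dX [g' Hg' ->]]; exists d => //; exists (g * g').
    exact: subgroupM gH Hg Hg'.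
  by rewrite edge_actM.
have X_actV g e : H g -> X (edge_act g^-1 e) -> X e.
  by move=> Hg /(X_act _ _ Hg); rewrite -edge_actM mulgV edge_act1.
have iV : stable_under H V.
  move=> g v Hg [d dV [g' Hg' ->]]; exists d => //; exists (g * g').
    exact: subgroupM gH Hg Hg'.
  by rewrite mulgA.
have walkX z e : z \in a -> e \in walk 1 (word_of S z) -> X e.
  move=> za ez; exists e; last by exists 1; rewrite ?edge_act1 //; exact: subgroup1 gH.
  by apply/flattenP; exists (walk 1 (word_of S z)) => //; apply: map_f.
have sep_walk e (u u' : seq (G * bool)) :
    word_over S (u ++ u') -> sep S e 1 (word_val u) -> e \in walk 1 (u ++ u').
  move=> /word_over_cat[Su _]; rewrite -[word_val u]mul1g sep_crossings //.
  rewrite walk_cat mem_cat /crossings => oe.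
  by rewrite -has_pred1 has_count; case: (count _ _) oe.
(* Elements with this property form a subgroup: an edge on the path to [x * y] lies on the path to
   [x] or on the translate by [x] of the path to [y]. *)
have sepH g e : H g -> sep S e 1 g -> X e.
  suff : H `<=` [set g | H g /\ forall e, sep S e 1 g -> X e] by move=> sub /sub[_]; apply.
  rewrite -{1}Ha; apply: generated_min => [|z za]; last first.
    split; first by rewrite -Ha; apply: generated_sub.
    move=> f sf; apply: (walkX z) => //; rewrite -[word_of S z]cats0; apply: sep_walk.
      by rewrite cats0; apply: word_of_over.
    by rewrite word_ofK.
  apply/subgroupP; split=> [|x y [Hx Xx] [Hy Xy]|x [Hx Xx]].
  - by split=> [|f]; [exact: subgroup1 gH|rewrite sepxx].
  - split=> [|f]; first exact: subgroupM.
    case/(sep_split x) => [/Xx //|]; rewrite -(sep_act freeS x^-1) mulVg mulKg.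
    by move/Xy/X_actV; apply.
  - have HVx := subgroupV gH Hx; split=> // f.
    rewrite -(sep_act freeS x) mulg1 mulgV sepC => /Xx.
    by rewrite -{1}[x]invgK => /X_actV; apply.
have sepV v e : V v -> sep S e 1 v -> X e.
  case=> d dV [g Hg ->] /(sep_split g)[/sepH|]; first exact.
  rewrite -(sep_act freeS g^-1) mulVg mulKg => sd; apply: (X_actV g) => //.
  move: dV sd; rewrite inE => /orP[/eqP->|]; first by rewrite sepxx.
  case/allpairsP=> -[f b] /= [/flattenP[_ /mapP[z za ->] fz] _ ->].
  have [u [w [E ->]]] := walk_ends b fz; rewrite mul1g => sd.
  apply: (walkX z) => //; rewrite E; apply: sep_walk => //.
  by rewrite -E; apply: word_of_over.
have sepVV x y e : V x -> V y -> sep S e x y -> X e.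
  by move=> /sepV Xx /sepV Xy /(sep_split 1)[|/Xy //]; rewrite sepC => /Xx.
exists V, rX, rV; split=> //.
- by exists 1; rewrite ?mem_head //; exists 1; rewrite ?mulg1 //; exact: subgroup1 gH.
- move=> e x y Vx Vy /(sepVV _ _ _ Vx Vy)[d dX [g Hg ->]] b; rewrite edge_end_act.
  exists (edge_end d b); last by exists g.
  by rewrite inE; apply/orP; right; apply: allpairs_f => //; case: (b).
- move=> e [Se Ve]; apply: (sepVV (edge_end e false) (edge_end e true)) => //.
  by rewrite (sep_edge_end freeS e false).
Qed.

End Hull.

Lemma infinite_stable (G : groupType) (S : set G) (H V : set G) :
    free_basis S [set: G] -> is_subgroup H -> H <> [set 1] ->
  stable_under H V -> V 1 -> infinite_set V.
Proof.
move=> freeS gH Hn1 iV V1; have [lt ltP lt_act] := left_order_exists freeS.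
have [g Hg g1] : exists2 g, H g & g != 1.
  apply: contrapT => ng; apply: Hn1; apply/seteqP; split=> [g Hg|_ ->].
    by apply/eqP; apply: contraT => g1; case: ng; exists g.
  exact: subgroup1 gH.
have Hgn n : H (g ^+ n).
  elim: n => [|n IH]; first exact: subgroup1 gH.
  by rewrite expgS; apply: subgroupM.
apply: (injective_infinite (f := fun n => g ^+ n)) => [m n|n]; last first.
  by rewrite -[g ^+ n]mulg1; apply: iV.
have inj i k : (i < k)%N -> g ^+ i != g ^+ k.
  move=> ik; have := torsion_free ltP lt_act (k - i).-1 g1.
  rewrite prednK ?subn_gt0 // expgnFr 1?ltnW //.
  by apply: contraNneq => ->; rewrite mulgV.
by case: (ltngtP m n) => // /inj/eqP nE /= E; case: nE.
Qed.

(** There are fewer than [size DV + h] edge orbits, and at least [size DV] of them are not bridges,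
    which leaves at most h - 1 orbits of bridges. *)
Lemma bridges_bound (G : groupType) (S : set G) (lt : rel G) (H V : set G) rX rV h :
    free_basis S [set: G] -> strict_total lt ->
    (forall g x y, lt (g * x) (g * y) = lt x y) ->
    is_subgroup H -> H <> [set 1] -> has_rank H h ->
    cofinite_subtree S H V rX rV ->
  exists2 r : seq (G * G), (size r < h)%N & forall e, bridge S lt V e ->
    exists2 d, d \in r & same_orbit (@edge_act G) H d e.
Proof.
move=> freeS ltP lt_act gH Hn1 [B [HB _] Bh] [V1 iV cV XrX VrV].
have [a sza Ba] := card_eq_seq Bh; rewrite Ba in HB.
have [DX XDX] := transversal_exists (@edge_act1 G) (@edge_actM G) gH XrX.
have [DV VDV] : exists D, transversal_of ( *%g ) H V D.
  by apply: transversal_exists VrV => // *; rewrite (mul1g, mulgA).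
have [uX DX_X XX rX'] := XDX.
exists [seq e <- DX | `[< bridge S lt V e >]] => [|e br]; last first.
  have [d dX [g Hg E]] := XX e (proj1 br); exists d; last by exists g.
  rewrite mem_filter dX andbT; apply/asboolP.
  have -> : d = edge_act g^-1 e by rewrite E edge_actK.
  by apply: (bridge_act freeS lt_act gH iV) br; apply: (subgroupV gH).
have szX := edge_orbits_leq freeS gH XDX VDV V1 HB.
have infV := infinite_stable freeS gH Hn1 iV V1.
have szV := nonbridges_geq freeS ltP lt_act gH iV cV XDX VDV infV.
have := count_predC (fun e => `[< bridge S lt V e >]) DX.
move: szX szV; rewrite !size_filter sza.
move: (size DX) (size DV) (count _ _) (count _ _) => n p q q'.
by clear; lia.
Qed.

Import GRing.Theory Num.Theory.

Theorem theorem1 (G : groupType) (H K : set G) (h k j : nat) :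
  is_free_group G ->
  is_subgroup H -> is_subgroup K ->
  finitely_generated H -> finitely_generated K ->
  H <> [set 1%g]%classic -> K <> [set 1%g]%classic ->
  has_rank H h -> has_rank K k -> has_rank (subgroup_join H K) j ->
  ((j%:Q - 1) >= (h%:Q + k%:Q - 1) / 2)%R ->
  exists r : nat, has_rank (H `&` K)%classic r /\
    (r%:Q - 1 <= (h%:Q - 1) * (k%:Q - 1))%R.
Proof.
move=> [S freeS] gH gK _ _ Hn1 Kn1 rH rK _ _.
have [lt ltP lt_act] := left_order_exists freeS.
have gL := is_subgroupI gH gK.
have hull M m : has_rank M m -> exists V rX rV, cofinite_subtree S M V rX rV.
  move=> [B [MB _] Bm]; have [a _ Ba] := card_eq_seq Bm; rewrite Ba in MB.
  exact: (hull_exists freeS MB).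
have [VH [XH [VH' hullH]]] := hull H h rH; have [VK [XK [VK' hullK]]] := hull K k rK.
have [bH szH brH] := bridges_bound freeS ltP lt_act gH Hn1 rH hullH.
have [bK szK brK] := bridges_bound freeS ltP lt_act gK Kn1 rK hullK.
have [[H1 iH cH XrH VrH] [K1 iK cK XrK VrK]] := (hullH, hullK).
pose V := VH `&` VK.
have V1 : V 1 by [].
have iV : stable_under (H `&` K) V.
  by move=> g v [Hg Kg] [Hv Kv]; split; [exact: iH|exact: iK].
have cV : convex S V.
  by move=> e x y [Hx Kx] [Hy Ky] exy b; split; [exact: cH exy b|exact: cK exy b].
have XVH e : edges_of S V e -> edges_of S VH e.
  by case=> Se Ve; split=> // b; case: (Ve b).
have XVK e : edges_of S V e -> edges_of S VK e.
  by case=> Se Ve; split=> // b; case: (Ve b).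
have [rX XrX] := orbitsI (@edge_actM G) (@edge_act_free G) gH gK
  (fun e Xe => XrH e (XVH e Xe)) (fun e Xe => XrK e (XVK e Xe)).
have mulg_actM (g g' v : G) : g * g' * v = g * (g' * v) by rewrite mulgA.
have mulg_free (g v : G) : g * v = v -> g = 1.
  by move=> E; apply: (@mulIg _ v); rewrite E mul1g.
have [rV VrV] := orbitsI mulg_actM mulg_free gH gK
  (fun v (Vv : V v) => VrH v (proj1 Vv)) (fun v Vv => VrK v (proj2 Vv)).
have [DX XDX] := transversal_exists (@edge_act1 G) (@edge_actM G) gL XrX.
have [DV VDV] := transversal_exists (@mul1g G) mulg_actM gL VrV.
have [r [rL szr]] := schreier_basis freeS gL iV cV V1 XDX VDV.
exists r; split=> //.
have szN := nonbridges_leq freeS ltP lt_act gL iV XDX VDV.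
have szB : (size [seq e <- DX | `[< bridge S lt V e >]] <= size bH * size bK)%N.
  have [uX DX_X XX rX'] := XDX; rewrite -(size_allpairs pair bH bK).
  apply: (@rel_leq_size _ _ (fun e p => same_orbit (@edge_act G) H p.1 e /\
                                        same_orbit (@edge_act G) K p.2 e)).
  - exact: filter_uniq.
  - have ball_sub e b W : V `<=` W -> ball S lt V e b `<=` ball S lt W e b.
      by move=> VW w [Vw we]; split=> //; apply: VW.
    move=> e; rewrite mem_filter => /andP[/asboolP[Xe inf] _].
    have [|d dH dHe] := brH e.
      split=> [|b fb]; first exact: XVH.
      by apply: (inf b); apply: sub_finite_set fb; apply: ball_sub => ? [].
    have [|d' dK dKe] := brK e.
      split=> [|b fb]; first exact: XVK.
      by apply: (inf b); apply: sub_finite_set fb; apply: ball_sub => ? [].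
    by exists (d, d') => //; apply: allpairs_f.
  move=> e e' [d d'] /=; rewrite !mem_filter => /andP[_ eX] /andP[_ e'X] _.
  move=> [[g Hg E] [g' Kg' E']] [[f Hf F] [f' Kf' F']].
  (* Bridges with the same pair of orbits differ by an element of [H] and by one of [K]; these agree
     because the action on edges is free. *)
  apply: rX' => //; have EF : e' = edge_act (f * g^-1) e by rewrite E -edge_actM mulgVK.
  have EF' : e' = edge_act (f' * g'^-1) e by rewrite E' -edge_actM mulgVK.
  exists (f * g^-1) => //; split.
    by apply: (subgroupM gH) => //; apply: (subgroupV gH).
  suff -> : f * g^-1 = f' * g'^-1 by apply: (subgroupM gK) => //; apply: (subgroupV gK).
  apply: (@mulIg _ e.1); exact: (congr1 fst (etrans (esym EF) EF')).
have szX := count_predC (fun e => `[< bridge S lt V e >]) DX.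
(* The strict bounds on [size bH] and [size bK] make both ranks positive; from here on [h] and [k]
   denote the ranks minus one. *)
case: h k szH szK {rH rK} => [//|h] [//|k] szH szK.
(* [r] minus one is at most the number of edge orbits less that of vertex orbits, hence at most the
   number of orbits of bridges. *)
have rhk : (r <= h * k + 1)%N.
  have bhk : (size bH * size bK <= h * k)%N by apply: leq_mul.
  move: szr szN szB szX bhk; rewrite !size_filter.
  move: (size DX) (size DV) (count _ _) (count _ _) (size bH * size bK)%N => n p q q' m.
  by move: (h * k)%N => hk; clear; lia.
have pred_rat n : (n.+1%:Q - 1 = n%:Q)%R by rewrite -addn1 PoszD intrD addrK.
rewrite !pred_rat lerBlDr -intrM -[X in (_ + X)%R]/(1%:Q)%R -intrD ler_int.
by move: rhk; clear; lia.
Qed.
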